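(* Let $\Gamma$ be a finitely generated group with a finite symmetric generating set $S$ and word length $|\cdot|$ with respect to $S$. For each $N$ let $\phi_N$ be a uniformly random element of $\mathrm{Hom}(\Gamma,\mathrm{Sym}(N))$ and $\pi_N=\mathrm{std}\circ\phi_N$. Let $\mu$ be a positive integer. Suppose the following two requirements hold. (1) There exist a constant $C\ge1$ and functions $u_k\colon\Gamma\to\mathbb{R}$ ($k=0,1,2,\dots$), with $u_0(\gamma)=\tau(\lambda(\gamma))$ for all $\gamma\in\Gamma$, such that for every $\gamma\in\Gamma$, every positive integer $s\ge|\gamma|$ and every integer $N\ge Cs^C$, $$\left|\mathbf{E}[\mathrm{tr}\,\pi_N(\gamma)]-\sum_{k=0}^{s-1}\frac{u_k(\gamma)}{N^{k/\mu}}\right|\le\frac{(Cs)^{Cs}}{N^{s/\mu}} .$$ (2) For every integer $1\le k\le\mu$, the linear extension $u_k\colon\mathbb{C}[\Gamma]\to\mathbb{C}$ is tempered at every self-adjoint element of $\mathbb{C}[\Gamma]$. Then for every $x\in\mathbb{C}[\Gamma]$ one has $\|\pi_N(x)\|\le\|\lambda(x)\|+o(1)$ with high probability as $N\to\infty$; that is, for every $\varepsilon>0$, $\mathbf{P}\big(\|\pi_N(x)\|\le\|\lambda(x)\|+\varepsilon\big)\to1$ as $N\to\infty$.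
   Context: $\mathrm{std}$ is the $(N-1)$-dimensional unitary representation of $\mathrm{Sym}(N)$ obtained by restricting the permutation representation on $\mathbb{C}^N$ to $\mathbf{1}^\perp$. $\mathrm{tr}\,\pi_N(\gamma)=\mathrm{Tr}(\pi_N(\gamma))/N$ is the trace normalized by $N$. $\lambda\colon\Gamma\to\mathcal{B}(\ell^2(\Gamma))$ is the left regular representation, and $\tau(a)=\langle a\delta_e,\delta_e\rangle$ is the canonical trace on the reduced $C^*$-algebra, so $\tau(\lambda(\gamma))=1$ if $\gamma=e$ and $0$ otherwise. Norms are operator norms. A linear functional $u\colon\mathbb{C}[\Gamma]\to\mathbb{C}$ is tempered at $x\in\mathbb{C}[\Gamma]$ if $\limsup_{p\to\infty}|u(x^p)|^{1/p}\le\|\lambda(x)\|$. The involution on $\mathbb{C}[\Gamma]$ is $(\sum\alpha_\gamma\gamma)^*=\sum\overline{\alpha_\gamma}\gamma^{-1}$; self-adjoint means $x^*=x$. *)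

(* Defs.v *)
Set Warnings "-notation-incompatible-prefix,-notation-overridden,-ambiguous-paths,-redundant-canonical-projection".
From HB Require Import structures.
From mathcomp Require Export all_boot all_order all_algebra all_fingroup finmap.
From mathcomp Require Export complex.
From mathcomp Require Import lra.
From mathcomp Require Export all_classical all_reals all_analysis.
(* The notations of monalg and those of mathcomp-analysis are incompatible. *)
From mathcomp.multinomials Require Import -(notations) monalg.

Set Implicit Arguments.
Unset Strict Implicit.
Unset Printing Implicit Defensive.

Export Order.TTheory GRing.Theory Num.Theory.
Export numFieldNormedType.Exports.
Export Normc.

Local Open Scope classical_set_scope.
Local Open Scope ring_scope.
Local Open Scope complex_scope.

Section WordLength.
Variable G : groupType.
Implicit Types (S : {fset G}) (g : G).

Definition has_word S g : pred nat := fun n =>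
  `[< exists w : n.-tuple G,
        {subset w <= S} /\ (\prod_(s <- w) s)%g = g >].

Definition symmetric_fset S := {in S, forall s, (s^-1)%g \in S}.

(* For a symmetric S, words in S are the same as words in S and inverses. *)
Definition generates S := forall g, exists n, has_word S g n.

Definition word_length S (genS : generates S) g : nat := ex_minn (genS g).

End WordLength.

Section GroupAlgebra.
Variables (K : nzRingType) (G : groupType).

(* Only the module structure comes from monalg, whose product is restricted to
   monoids without non-trivial units. *)
Definition grpalg := malg G K.
HB.instance Definition _ := GRing.Lmodule.on grpalg.

Implicit Types (c : K) (g h : G) (x y z : grpalg).

Definition gterm c g : grpalg := mkmalgU g c.

Definition grpalg_one : grpalg := gterm 1 1%g.

Definition grpalg_mul x y : grpalg :=
  \sum_(g <- msupp x) \sum_(h <- msupp y)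
    gterm (mcoeff g x * mcoeff h y) (g * h)%g.

Lemma gterm0 g : gterm 0 g = 0.
Proof. exact: monalgU0. Qed.

Lemma gtermD g : {morph gterm^~ g : c d / c + d}.
Proof. exact: monalgUD. Qed.

Lemma grpalgE x : x = \sum_(g <- msupp x) gterm (mcoeff g x) g.
Proof. exact: monalgE. Qed.

Lemma grpalg_mulw (d1 d2 : {fset G}) x y :
  (msupp x `<=` d1)%fset -> (msupp y `<=` d2)%fset ->
  grpalg_mul x y = \sum_(g <- d1) \sum_(h <- d2)
    gterm (mcoeff g x * mcoeff h y) (g * h)%g.
Proof.
move=> le1 le2; rewrite /grpalg_mul (big_fset_incl _ le1) /=.
  apply/eq_bigr => g _; apply/big_fset_incl => // h _ /mcoeff_outdom ->.
  by rewrite mulr0 gterm0.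
move=> g _ /mcoeff_outdom xg.
by rewrite big1 => // h _; rewrite xg mul0r gterm0.
Qed.

Lemma grpalg_mulDl : left_distributive grpalg_mul +%R.
Proof.
move=> x y z.
rewrite [in RHS](grpalg_mulw (fsubsetUl _ (msupp y)) (fsubset_refl _)).
rewrite [in RHS](grpalg_mulw (fsubsetUr (msupp x) _) (fsubset_refl _)).
rewrite (grpalg_mulw (msuppD_le _ _) (fsubset_refl _)) -big_split /=.
apply/eq_bigr => g _; rewrite -big_split /=; apply/eq_bigr => h _.
by rewrite mcoeffD mulrDl gtermD.
Qed.

Lemma grpalg_mulDr : right_distributive grpalg_mul +%R.
Proof.
move=> x y z.
rewrite [in RHS](grpalg_mulw (fsubset_refl _) (fsubsetUl _ (msupp z))).
rewrite [in RHS](grpalg_mulw (fsubset_refl _) (fsubsetUr (msupp y) _)).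
rewrite (grpalg_mulw (fsubset_refl _) (msuppD_le _ _)) -big_split /=.
apply/eq_bigr => g _; rewrite -big_split /=; apply/eq_bigr => h _.
by rewrite mcoeffD mulrDr gtermD.
Qed.

Lemma grpalg_mul0r x : grpalg_mul 0 x = 0.
Proof. by rewrite /grpalg_mul msupp0 big_seq_fset0. Qed.

Lemma grpalg_mulr0 x : grpalg_mul x 0 = 0.
Proof. by rewrite /grpalg_mul big1// => g _; rewrite msupp0 big_seq_fset0. Qed.

Lemma gtermM c d g h :
  grpalg_mul (gterm c g) (gterm d h) = gterm (c * d) (g * h)%g.
Proof. by rewrite (grpalg_mulw msuppU_le msuppU_le) !big_seq_fset1 !mcoeffUU. Qed.

Lemma grpalg_mul_suml (I : Type) (r : seq I) (F : I -> grpalg) y :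
  grpalg_mul (\sum_(i <- r) F i) y = \sum_(i <- r) grpalg_mul (F i) y.
Proof.
exact: (big_morph (grpalg_mul^~ y) (fun _ _ => grpalg_mulDl _ _ _) (grpalg_mul0r _)).
Qed.

Lemma grpalg_mul_sumr (I : Type) (r : seq I) (F : I -> grpalg) x :
  grpalg_mul x (\sum_(i <- r) F i) = \sum_(i <- r) grpalg_mul x (F i).
Proof.
exact: (big_morph (grpalg_mul x) (fun _ _ => grpalg_mulDr _ _ _) (grpalg_mulr0 _)).
Qed.

Lemma grpalg_mul1r : left_id grpalg_one grpalg_mul.
Proof.
move=> x; rewrite [in LHS](grpalgE x) [RHS]grpalgE grpalg_mul_sumr.
by apply/eq_bigr => g _; rewrite gtermM mul1r mul1g.
Qed.

Lemma grpalg_mulr1 : right_id grpalg_one grpalg_mul.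
Proof.
move=> x; rewrite [in LHS](grpalgE x) [RHS]grpalgE grpalg_mul_suml.
by apply/eq_bigr => g _; rewrite gtermM mulr1 mulg1.
Qed.

Lemma grpalg_mulA : associative grpalg_mul.
Proof.
move=> x y z; rewrite (grpalgE x) (grpalgE y) (grpalgE z).
rewrite [LHS]grpalg_mul_suml (grpalg_mul_suml _ _ (\sum_(g <- msupp y) _)).
rewrite [RHS]grpalg_mul_suml; apply/eq_bigr => g _.
rewrite grpalg_mul_suml [LHS]grpalg_mul_sumr.
rewrite (grpalg_mul_sumr _ _ (gterm _ g)) [RHS]grpalg_mul_suml.
apply/eq_bigr => h _; rewrite !grpalg_mul_sumr; apply/eq_bigr => k _.
by rewrite !gtermM mulrA mulgA.
Qed.

Lemma grpalg_oner_neq0 : grpalg_one != 0.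
Proof. by rewrite /grpalg_one /gterm monalgU_eq0 oner_eq0. Qed.

HB.instance Definition _ := GRing.Zmodule_isNzRing.Build grpalg
  grpalg_mulA grpalg_mul1r grpalg_mulr1 grpalg_mulDl grpalg_mulDr
  grpalg_oner_neq0.

Definition linext (V : lmodType K) (f : G -> V) (x : grpalg) : V :=
  \sum_(g <- msupp x) mcoeff g x *: f g.

End GroupAlgebra.

Section ComplexGroupAlgebra.
Variables (R : realType) (G : groupType).

Definition grpalg_star (x : grpalg R[i] G) : grpalg R[i] G :=
  \sum_(g <- msupp x) gterm (mcoeff g x)^* (g^-1)%g.

Definition self_adjoint (x : grpalg R[i] G) := grpalg_star x = x.

End ComplexGroupAlgebra.

Section OperatorNorm.
Variable R : realType.
Local Open Scope ereal_scope.

(* nrm takes the value +oo outside the normed space, so the supremum is over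
   its closed unit ball. *)
Definition opnorm (V : Type) (nrm : V -> \bar R) (T : V -> V) : \bar R :=
  ereal_sup [set nrm (T v) | v in [set v | nrm v <= 1]].

End OperatorNorm.

Section SquareSummable.
Variables (R : realType) (I : choiceType).
Implicit Types f g : I -> R[i].

(* l^2(I) is the set of functions of finite ell2norm. *)
Definition ell2norm f : \bar R :=
  sqrte (\esum_(i in [set: I]) (normc (f i) ^+ 2)%:E)%E.

Definition rsum (a : I -> R) : R :=
  fine (\esum_(i in [set: I]) (Num.max (a i) 0)%:E)%E -
  fine (\esum_(i in [set: I]) (Num.max (- a i) 0)%:E)%E.

(* The sum of an absolutely summable family of complex numbers. *)
Definition csum (a : I -> R[i]) : R[i] :=
  rsum (fun i => complex.Re (a i)) +i* rsum (fun i => complex.Im (a i)).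

Definition ell2dot f g : R[i] := csum (fun i => f i * (g i)^*).

End SquareSummable.

Section RegularRepresentation.
Variables (R : realType) (G : groupType).
Implicit Types (g : G) (f : G -> R[i]).

(* Operators on l^2(G) are restrictions of maps on all functions on G. *)
Definition lreg g f : G -> R[i] := fun h => f (g^-1 * h)%g.

Definition lambda (x : grpalg R[i] G) f : G -> R[i] :=
  linext (fun g => lreg g f) x.

Definition lambda_norm x : \bar R := opnorm (@ell2norm R G) (lambda x).

Definition delta1 : G -> R[i] := fun h => (h == 1%g)%:R.

Definition tau (a : (G -> R[i]) -> (G -> R[i])) : R[i] :=
  ell2dot (a delta1) delta1.

Lemma lambda_gterm g : lambda (gterm 1 g) = lreg g.
Proof.
apply/funext => f; rewrite /lambda /linext /gterm msuppU oner_eq0.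
by rewrite big_seq_fset1 mcoeffUU scale1r.
Qed.

Lemma rsum_unit (a : G -> R) : (forall g, g != 1%g -> a g = 0) ->
  rsum a = a 1%g.
Proof.
move=> a0; have E (b : G -> R) : (forall g, g != 1%g -> b g = 0) ->
    0 <= b 1%g -> (\esum_(g in [set: G]) (b g)%:E)%E = (b 1%g)%:E.
  move=> b0 b1; rewrite -(@esum_set1 _ _ 1%g (fun g => (b g)%:E)) ?lee_fin//.
  rewrite [RHS]esum_mkcond; apply: eq_esum => g _.
  by case: ifPn => // /negP; rewrite inE /= => /eqP /b0 ->.
rewrite /rsum !E /= ?le_max ?lexx ?orbT//;
  try by move=> g /a0 ->; rewrite ?oppr0 maxxx.
rewrite !maxEle oppr_le0; case: (lerP (a 1%g) 0) => h;
  by case: (lerP 0 (a 1%g)) => h'; lra.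
Qed.

Lemma tau_lreg g : tau (lreg g) = (g == 1%g)%:R.
Proof.
rewrite /tau /ell2dot /csum.
have d0 h : h != 1%g -> lreg g delta1 h * (delta1 h)^* = 0.
  by move=> /negPf h1; rewrite [X in _ * X^*]/delta1 h1 rmorph0 mulr0.
rewrite !rsum_unit; try by move=> h /d0 ->.
by rewrite /lreg /delta1 mulg1 eqxx invg_eq1 rmorph1 mulr1; case: (g == _).
Qed.

Definition tempered (u : grpalg R[i] G -> R[i]) (x : grpalg R[i] G) :=
  (limn_esup (fun p => (normc (u (x ^+ p)) `^ p%:R^-1)%:E) <= lambda_norm x)%E.

End RegularRepresentation.

Section StandardRepresentation.
Variables (R : realType) (N : nat).
Local Notation C := R[i].

(* The orthogonal complement of the all-one vector in C^N. *)
Definition one_perp : {vspace 'cV[C]_N} :=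
  lker (linfun (mulmx (const_mx 1 : 'rV[C]_N)) : 'Hom('cV[C]_N, 'cV[C]_1)).

Definition std_space := subvs_of one_perp.

(* Permutations are multiplied in the order opposite to composition, and
   perm_mx s *m v is v \o s, so that perm_mx is multiplicative: up to
   s |-> s^-1 this is the permutation representation of Sym(N). *)
Definition std_fun (s : 'S_N) (v : std_space) : std_space :=
  vsproj one_perp (perm_mx s *m vsval v).

Definition std (s : 'S_N) : 'End(std_space) := linfun (std_fun s).

Definition std_trace (a : 'End(std_space)) : C :=
  \tr (passmx.mxof (vbasis {:std_space}) (vbasis {:std_space}) a).

Definition std_vnorm (v : std_space) : \bar R :=
  (Num.sqrt (\sum_i normc (vsval v i 0) ^+ 2))%:E.

Definition std_norm (a : 'End(std_space)) : \bar R := opnorm std_vnorm a.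

Lemma mem_one_perp v : (v \in one_perp) = (\sum_i v i 0 == 0).
Proof.
have e : ((const_mx 1 : 'rV[C]_N) *m v) 0 0 = \sum_i v i 0.
  by rewrite mxE; apply/eq_bigr => i _; rewrite mxE mul1r.
rewrite memv_ker lfunE /= -e; apply/eqP/eqP => [->|v0]; first by rewrite mxE.
by apply/matrixP => i j; rewrite !ord1 v0 mxE.
Qed.

Lemma one_perp_perm s v : v \in one_perp -> perm_mx s *m v \in one_perp.
Proof.
rewrite !mem_one_perp => /eqP v0; apply/eqP; rewrite -[RHS]v0.
rewrite [RHS](reindex_inj (@perm_inj _ s)).
by apply: eq_bigr => i _; rewrite -row_permE mxE.
Qed.

Lemma std_fun_is_linear s : linear (std_fun s).
Proof. by move=> a u v; rewrite /std_fun !linearP. Qed.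

HB.instance Definition _ s := GRing.isLinear.Build C std_space std_space _
  (std_fun s) (std_fun_is_linear s).

Lemma stdE s v : vsval (std s v) = perm_mx s *m vsval v.
Proof. by rewrite lfunE /= vsprojK// one_perp_perm// subvsP. Qed.

Lemma stdM s t : std (s * t)%g = (std s \o std t)%VF.
Proof.
by apply/lfunP => v; apply: subvs_inj; rewrite comp_lfunE !stdE perm_mxM mulmxA.
Qed.

End StandardRepresentation.

Section RandomHomomorphism.
Variables (G : groupType) (N : nat).

Definition homs : set (G -> 'S_N) := 
  [set phi : G -> 'S_N | {morph phi : g h / (g * h)%g}].

Lemma homs_nonempty : homs !=set0.
Proof. by exists (fun=> 1%g) => g h /=; rewrite mulg1. Qed.

Lemma homs_word phi (w : seq G) : homs phi ->
  phi (\prod_(s <- w) s)%g = (\prod_(s <- w) phi s)%g.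
Proof.
move=> phiM; apply: (big_morph phi phiM).
by apply: (mulgI (phi 1%g)); rewrite -phiM !mulg1.
Qed.

Lemma finite_homs (S : {fset G}) : generates S -> finite_set homs.
Proof.
move=> genS; pose res (phi : G -> 'S_N) : {ffun S -> 'S_N} :=
  [ffun s => phi (val s)].
rewrite -(eq_finite_set (@inj_card_eq _ _ homs res _)); first exact: finite_finset.
move=> phi psi; rewrite !inE => Hphi Hpsi e.
apply/funext => g; have [n /asboolP[w [wS <-]]] := genS g.
rewrite !homs_word//; apply: eq_big_seq => s /wS sS.
by have := congr1 (fun r : {ffun _} => r [` sS]%fset) e; rewrite !ffunE.
Qed.

End RandomHomomorphism.

Arguments homs : clear implicits.

Section Uniform.
Variables (R : realType) (T : choiceType) (A : set T).

(* The uniform law on A, for a finite non-empty A. *)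
Definition unifE (f : T -> R[i]) : R[i] :=
  (\sum_(a <- fset_set A) f a) / (#|` fset_set A|)%:R.

Definition unifP (B : set T) : R :=
  (#|` fset_set (A `&` B)|)%:R / (#|` fset_set A|)%:R.

End Uniform.

Section RandomRepresentation.
Variables (R : realType) (G : groupType) (N : nat).

Definition pi_rep (phi : G -> 'S_N) (g : G) : 'End(std_space R N) :=
  std R (phi g).

Definition pi_alg (phi : G -> 'S_N) (x : grpalg R[i] G) : 'End(std_space R N) :=
  linext (pi_rep phi) x.

Definition ntrace (a : 'End(std_space R N)) : R[i] := std_trace a / N%:R.

End RandomRepresentation.

(* Main.v *)
Require Import Defs.
From mathcomp Require Import spectral polyrcf ring lra zify.
From mathcomp.multinomials Require Import -(notations) monalg.

Set Warnings "-notation-overridden".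
Set Implicit Arguments.
Unset Strict Implicit.
Unset Printing Implicit Defensive.

Local Open Scope classical_set_scope.
Local Open Scope ring_scope.
Local Open Scope complex_scope.

(** Let [rho] be the norm of [lambda(x)] and let [y] be the adjoint of [x]
    times [x], so that the norm of [lambda(y)] is at most [rho^2]. The norm of
    [pi_N(x)] exceeds [rho + eps] only if the positive matrix [pi_N(y)] has an
    eigenvalue above [(rho + eps)^2]. If [h >= 0] is a polynomial that is at
    least [k] on such eigenvalues, the probability of this event is at most
    [N * E tr h(pi_N(y)) / k] by Markov's inequality. The expectation has the
    expansion with terms [u_k(h(y)) N^(-k/mu)], so that the terms with
    [k <= mu] have to be negligible, and the terms with [k > mu] gain
    [N^(-1/mu)] over the factor [N] provided that their coefficients do not
    grow too fast with the degree of [h]. The degree will be of order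
    [log N].

    Terms with [k <= mu]. Temperedness bounds [u_k(y^j)] by [B r1^j] with [r1]
    slightly above [rho^2] ([tempered_bound], [low_order_bound]; for [k = 0]
    this is the bound of the canonical trace by the operator norm). Hence
    [u_k(h(y))] is at most [B] times the value at [r1] of the polynomial whose
    coefficients are the absolute values of those of [h]. This majorant is
    submultiplicative, so it is enough to find one polynomial [f], with values
    in [[0, 1]] on the spectrum, close to [1] beyond [(rho + eps)^2], and with
    a small majorant at [r1] ([sep_poly]); then [h = f^m] has exponentially
    small [u_k(h(y))].

    Terms with [k > mu]. The error [(C s)^(C s)] in the hypothesis yields only
    useless bounds on [u_k(h(y))] if applied term by term. But truncated at an
    order [s] proportional to the degree of [h], the expansion is a polynomial
    in [N^(-1/mu)] of degree less than [s], and it is bounded by [2] whenever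
    [N] is at least a power of [s], because [tr h(pi_N(y))] lies in [[0, 1]].
    The points [N^(-1/mu)] are so dense near [0] that the inequality of the
    Markov brothers ([markov]) propagates the bound to an interval whose
    length is an inverse power of [s], and then bounds the coefficient of
    order [k] by the [k]-th power of a fixed power of [s]
    ([coef_bound_of_net], [pairing_expansion]). For [s] of order [log N] this
    loses only powers of [log N] ([bad_cvg0]).

    The remaining work identifies the objects. On the algebraic side, norms of
    [lambda] are tested on the group algebra itself ([lambda_norm_sqn],
    [sqn_lambda_norm]), which gives the bound on [lambda(y)]
    ([lambda_norm_starM]). On the matrix side, the spectral theorem expresses
    both the trace moments and the operator norm in the standard
    representation through the eigenvalues of one Gram matrix
    ([spectral_moments]). *)

(** * Chebyshev polynomials and the Markov brothers' inequality *)

Section Chebyshev.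
Variable R : realType.
Implicit Types p q : {poly R}.

Fixpoint cheb (n : nat) : {poly R} :=
  match n with
  | 0 => 1
  | S m => match m with 0 => 'X | S k => 'X * cheb m *+ 2 - cheb k end
  end.

Lemma chebSS n : cheb n.+2 = 'X * cheb n.+1 *+ 2 - cheb n.
Proof. by []. Qed.

Lemma size_cheb n : (size (cheb n) <= n.+1)%N.
Proof.
suff: (size (cheb n) <= n.+1)%N && (size (cheb n.+1) <= n.+2)%N by case/andP.
elim: n => [|n /andP[IH0 IH1]]; first by rewrite size_poly1 size_polyX.
rewrite IH1 chebSS /=.
apply: leq_trans (size_polyD _ _) _; rewrite size_polyN geq_max.
rewrite (leq_trans IH0 _) ?andbT; last by lia.
rewrite mulr2n (leq_trans (size_polyD _ _)) // maxnn.
by apply: leq_trans (size_polyMleq _ _) _; rewrite size_polyX.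
Qed.

End Chebyshev.

Section Markov.
Variable R : realType.
Implicit Types p q : {poly R}.

Lemma horner_cheb_cos n (t : R) : (cheb R n).[cos t] = cos (n%:R * t).
Proof.
suff: (cheb R n).[cos t] = cos (n%:R * t) /\
      (cheb R n.+1).[cos t] = cos (n.+1%:R * t) by case.
elim: n => [|n [IH0 IH1]]; first by rewrite hornerC hornerX mul0r mul1r cos0.
split=> //; rewrite chebSS hornerD hornerN hornerMn hornerM hornerX IH0 IH1.
have -> : n.+2%:R * t = n.+1%:R * t + t by rewrite -(natr1 n.+1); ring.
have -> : n%:R * t = n.+1%:R * t - t by rewrite -(natr1 n); ring.
rewrite [in LHS]cosB [in RHS]cosD; ring.
Qed.

Lemma deriv_cheb1 n : (cheb R n)^`().[1] = n%:R ^+ 2.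
Proof.
suff: [/\ (cheb R n)^`().[1] = n%:R ^+ 2, (cheb R n.+1)^`().[1] = n.+1%:R ^+ 2,
  (cheb R n).[1] = 1 & (cheb R n.+1).[1] = 1] by case.
elim: n => [|n [IH0 IH1 e0 e1]].
  by rewrite derivC derivX !hornerE expr0n expr1n.
split=> //.
  rewrite chebSS derivB derivMn derivM derivX mul1r hornerD hornerN hornerMn.
  rewrite hornerD hornerM hornerX IH0 IH1 e1 -(natr1 n.+1) -(natr1 n); ring.
rewrite chebSS hornerD hornerN hornerMn hornerM hornerX e0 e1; ring.
Qed.

(** The extremality of the Chebyshev polynomial [T]. If [p'(1)] exceeded
    [n^2 = T'(1)], then [q = T - c p], with [c < 1] chosen so that
    [q'(1) = 0], would still alternate in sign at the [n + 1] extrema of [T]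
    (where [|T| = 1 > c |p|]). Its [n] roots give, by Rolle, [n - 1] roots of
    [q'] to the left of [1]; together with [1] these are more than the degree
    of [q'] allows. *)
Lemma markov_endpoint_le n p : (size p <= n.+1)%N ->
  (forall t, -1 <= t <= 1 -> `|p.[t]| <= 1) -> p^`().[1] <= n%:R ^+ 2.
Proof.
case: n => [|n] szp p1.
  by rewrite (size1_polyC szp) derivC horner0 expr0n.
rewrite leNgt; apply/negP => big.
have n1_gt0 : (0 : R) < n.+1%:R by rewrite ltr0n.
have p'_gt0 : 0 < p^`().[1] by apply: lt_trans big; rewrite exprn_gt0.
(* Chosen so that the derivative of [q] vanishes at 1. *)
pose c : R := n.+1%:R ^+ 2 / p^`().[1].
have c_gt0 : 0 < c by rewrite divr_gt0 // exprn_gt0.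
have c_lt1 : c < 1 by rewrite ltr_pdivrMr // mul1r.
pose q := cheb R n.+1 - c *: p.
pose x k : R := cos (k%:R * (pi / n.+1%:R)).
have pin_gt0 : 0 < pi / n.+1%:R :> R by rewrite divr_gt0 ?pi_gt0.
have nth_itv k : (k <= n.+1)%N -> k%:R * (pi / n.+1%:R) \in `[0, pi : R].
  move=> kn; rewrite in_itv /= mulr_ge0 ?(ltW pin_gt0) //= mulrCA.
  by rewrite ger_pMr ?pi_gt0 // ler_pdivrMr // mul1r ler_nat.
have x_decr k : (k <= n)%N -> x k.+1 < x k.
  by move=> kn; rewrite ltr_cos ?nth_itv ?ltr_pM2r ?ltr_nat //; lia.
have qx k : (k <= n.+1)%N -> 0 < (-1) ^+ k * q.[x k].
  move=> kn; rewrite hornerD hornerN hornerZ horner_cheb_cos.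
  have -> : n.+1%:R * (k%:R * (pi / n.+1%:R)) = 0 + pi *+ k :> R.
    by rewrite add0r -mulr_natl; field; rewrite gt_eqF.
  have -> : cos (0 + pi *+ k) = (-1) ^+ k :> R.
    elim: (k) => [|j IH]; first by rewrite mulr0n addr0 cos0.
    by rewrite mulrS addrCA addrC cosDpi IH exprS mulN1r.
  rewrite mulrBr -expr2 sqrr_sign subr_gt0.
  apply: le_lt_trans (ler_norm _) _; rewrite normrM normr_sign mul1r normrM.
  rewrite gtr0_norm //; apply: le_lt_trans c_lt1.
  by rewrite ger_pMr // p1 // cos_geN1 cos_le1.
have ex_y k : exists y, (k <= n)%N -> (x k.+1 < y < x k) && root q y.
  case: (leqP k n) => kn; last by exists 0.
  have [|y yI ry] := @poly_ivtoo R q (x k.+1) (x k) (ltW (x_decr _ kn)).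
    have := mulr_gt0 (qx k.+1 kn) (qx k (leqW kn)).
    by rewrite exprS mulN1r !mulNr oppr_gt0 mulrACA -expr2 sqrr_sign mul1r.
  by exists y => _; rewrite ry andbT; move: yI; rewrite in_itv.
have [y yP] := choice ex_y.
have yS k : (k < n)%N -> y k.+1 < y k.
  move=> kn; have /andP[/andP[_ h1] _] := yP k.+1 kn.
  have /andP[/andP[h2 _] _] := yP k (ltnW kn).
  exact: lt_trans h1 h2.
have ex_z k : exists z, (k < n)%N -> (y k.+1 < z < y k) && root q^`() z.
  case: (ltnP k n) => kn; last by exists 0.
  have /andP[_ /rootP r1] := yP k.+1 kn.
  have /andP[_ /rootP r0] := yP k (ltnW kn).
  have [z zI rz] := @poly_rolle R (y k.+1) (y k) q (yS k kn) (etrans r1 (esym r0)).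
  by exists z => _; move: zI; rewrite in_itv /= => ->; apply/rootP.
have [z zP] := choice ex_z.
have z_decr j k : (j < k)%N -> (k < n)%N -> z k < z j.
  elim: k => // k IH; rewrite ltnS leq_eqVlt => /orP[/eqP <- {IH}|jk] kn.
    have /andP[/andP[_ h1] _] := zP j.+1 kn.
    have /andP[/andP[h2 _] _] := zP j (ltnW kn).
    exact: lt_trans h1 h2.
  apply: lt_trans (IH jk (ltnW kn)).
  have /andP[/andP[_ h1] _] := zP k.+1 kn.
  have /andP[/andP[h2 _] _] := zP k (ltnW kn).
  exact: lt_trans h1 h2.
have x0 : x 0%N = 1 by rewrite /x mul0r cos0.
have y_lt1 k : (k <= n)%N -> y k < 1.
  move=> kn; have /andP[/andP[_ h1] _] := yP k kn.
  by apply: lt_le_trans h1 _; rewrite cos_le1.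
have q'0 : q^`() = 0.
  apply: (@poly_ltsp_roots R _ (1 :: [seq z k | k <- iota 0 n])).
  - rewrite /= size_map size_iota; apply: leq_trans (_ : n.+1 <= _)%N => //.
    have szq : (size q <= n.+2)%N.
      apply: leq_trans (size_polyD _ _) _; rewrite size_polyN geq_max size_cheb.
      by rewrite (leq_trans (size_scale_leq _ _)).
    have [->|q0] := eqVneq q 0; first by rewrite deriv0 size_poly0.
    by rewrite -ltnS; exact: leq_trans (lt_size_deriv q0) szq.
  - rewrite /= map_inj_in_uniq ?iota_uniq ?andbT.
      apply/negP => /mapP[k]; rewrite mem_iota add0n => /andP[_ kn] e.
      have /andP[/andP[_ h1] _] := zP k kn.
      by have := lt_trans h1 (y_lt1 k (ltnW kn)); rewrite -e ltxx.
    move=> j k; rewrite !mem_iota !add0n => /andP[_ jn] /andP[_ kn] e.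
    case: (ltngtP j k) => // jk.
      by have := z_decr j k jk kn; rewrite e ltxx.
    by have := z_decr k j jk jn; rewrite e ltxx.
  apply/andP; split.
    apply/rootP; rewrite derivB derivZ hornerD hornerN hornerZ deriv_cheb1.
    by rewrite /c divfK ?subrr // gt_eqF.
  by apply/allP => t /mapP[k]; rewrite mem_iota add0n => /andP[_ /zP /andP[_ ?]] ->.
have [w _] := @poly_mvt R (y 0%N) 1 q (y_lt1 0%N isT).
rewrite q'0 horner0 mul0r; have /andP[_ /rootP ->] := yP 0%N isT.
by have := qx 0%N isT; rewrite x0 mul1r subr0 => + q0; rewrite q0 ltxx.
Qed.

(** Homogenization: dividing by [M + e] instead of [M] covers [M = 0]. *)
Lemma markov_endpoint n p (M : R) : (size p <= n.+1)%N ->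
  (forall t, -1 <= t <= 1 -> `|p.[t]| <= M) -> `|p^`().[1]| <= n%:R ^+ 2 * M.
Proof.
move=> szp pM.
have M_ge0 : 0 <= M by apply: le_trans (pM 1 _); rewrite ?lexx ?andbT //; lra.
suff key (e : R) : 0 < e -> `|p^`().[1]| <= n%:R ^+ 2 * (M + e).
  apply/ler_addgt0Pr => e e0.
  have n1 : 0 < n%:R ^+ 2 + 1 :> R by have := sqr_ge0 (n%:R : R); lra.
  apply: le_trans (key (e / (n%:R ^+ 2 + 1)) (divr_gt0 e0 n1)) _.
  rewrite mulrDr lerD2l mulrCA ger_pMr // ler_pdivrMr // mul1r.
  by rewrite lerDl ler01.
move=> e0; have Me : 0 < M + e by lra.
have szs (a : R) : (size (a *: p) <= n.+1)%N.
  exact: leq_trans (size_scale_leq _ _) szp.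
have bnd (a : R) : `|a| = (M + e)^-1 -> a * p^`().[1] <= n%:R ^+ 2.
  move=> ea; rewrite -hornerZ -derivZ; apply: markov_endpoint_le => // t tI.
  rewrite hornerZ normrM ea mulrC ler_pdivrMr // mul1r.
  by apply: le_trans (pM t tI) _; lra.
have i0 : 0 < (M + e)^-1 by rewrite invr_gt0.
have h1 := bnd (M + e)^-1 (gtr0_norm i0).
have h2 := bnd (- (M + e)^-1) (etrans (normrN _) (gtr0_norm i0)).
case: (ger0P p^`().[1]) => _; rewrite -ler_pdivrMr // mulrC //.
by rewrite mulrN -mulNr.
Qed.

(** The endpoint inequality transported to the segment from [b] to [a] by the
    affine map sending [1] to [b] and [-1] to [a]. *)
Lemma markov_segment n p (M a b : R) : a != b -> (size p <= n.+1)%N ->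
  (forall t, 0 <= t <= 1 -> `|p.[b + t * (a - b)]| <= M) ->
  `|p^`().[b]| <= n%:R ^+ 2 * M * 2 / `|b - a|.
Proof.
move=> ab szp pM.
pose l : R := (b - a) / 2.
have l0 : l != 0 by rewrite mulf_neq0 ?invr_eq0 ?pnatr_eq0 // subr_eq0 eq_sym.
pose r := p \Po (l *: 'X + (b - l)%:P).
have szr : (size r <= n.+1)%N.
  rewrite size_comp_poly2 // size_polyDl ?size_scale ?size_polyX //.
  by rewrite size_polyC; case: (_ != 0).
have rE t : r.[t] = p.[b + (1 - t) / 2 * (a - b)].
  rewrite horner_comp hornerD hornerZ hornerX hornerC; congr (p.[_]).
  by rewrite /l; field.
have := @markov_endpoint n r M szr.
have -> : r^`().[1] = p^`().[b] * l.
  rewrite deriv_comp hornerM horner_comp derivD derivZ derivX derivC addr0.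
  rewrite hornerZ hornerC mulr1 hornerD hornerZ hornerX hornerC mulr1.
  by congr (p^`().[_] * _); rewrite /l; field.
move=> h; rewrite ler_pdivlMr ?normr_gt0 ?subr_eq0 1?eq_sym //.
rewrite -normrM -[b - a](@divfK _ 2) ?pnatr_eq0 // mulrA normrM.
rewrite (ger0_norm (ler0n _ 2)) ler_wpM2r // h // => t tI; rewrite rE pM //.
by lra.
Qed.

(** Every point of [[0, b]] is an endpoint of a subsegment of length at least
    [b / 2], so the endpoint inequality gives, up to a factor, the inequality
    at interior points as well. *)
Lemma markov n p (M b : R) : 0 < b -> (size p <= n.+1)%N ->
  (forall t, 0 <= t <= b -> `|p.[t]| <= M) ->
  forall t, 0 <= t <= b -> `|p^`().[t]| <= 4 * n%:R ^+ 2 / b * M.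
Proof.
move=> b0 szp pM t /andP[t0 tb].
have M_ge0 : 0 <= M by apply: le_trans (pM 0 _) => //; rewrite lexx ltW.
have nM : 0 <= n%:R ^+ 2 * M * 2 by rewrite !mulr_ge0 // sqr_ge0.
have fin (l : R) : b / 2 <= l ->
    n%:R ^+ 2 * M * 2 / l <= 4 * n%:R ^+ 2 / b * M.
  move=> bl; have -> : 4 * n%:R ^+ 2 / b * M = n%:R ^+ 2 * M * 2 / (b / 2).
    by field; rewrite gt_eqF.
  by rewrite ler_wpM2l // lef_pV2 // posrE; lra.
case: (lerP t (b / 2)) => tb2.
  apply: le_trans (@markov_segment n p M b t _ szp _) (fin _ _).
  - by apply/eqP; lra.
  - by move=> w wI; apply: pM; apply/andP; split; nra.
  - by rewrite ler0_norm; lra.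
apply: le_trans (@markov_segment n p M 0 t _ szp _) (fin _ _).
- by apply/eqP; lra.
- by move=> w wI; apply: pM; apply/andP; split; nra.
- by rewrite ger0_norm; lra.
Qed.

(** Iterating the previous bound on derivatives, and dropping the gain of
    [k!] in passing from the [k]-th derivative at [0] to the coefficient. *)
Lemma markov_coef n p (M b : R) : 0 < b -> (size p <= n.+1)%N ->
  (forall t, 0 <= t <= b -> `|p.[t]| <= M) ->
  forall k, `|p`_k| <= (4 * n%:R ^+ 2 / b) ^+ k * M.
Proof.
move=> b0 szp pM k; elim: k p M szp pM => [|k IH] p M szp pM.
  by rewrite mul1r -horner_coef0 pM // lexx ltW.
have szd : (size p^`() <= n.+1)%N.
  exact: leq_trans (leq_trans (size_poly _ _) (leq_pred _)) szp.
have := IH _ _ szd (markov b0 szp pM).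
rewrite coef_deriv mulrA -exprSr => h; apply: le_trans h.
by rewrite normrMn mulrS lerDl mulrn_wge0.
Qed.

End Markov.

(** * From bounds on a fine net to coefficient bounds *)

Section DiscreteBound.
Variable R : realType.
Implicit Types p q : {poly R}.

(** At a maximum [w] of [|p|] the Markov inequality makes [p] so flat that
    [|p w|] drops by at most half of itself before the next point of the net;
    hence [|p w| <= 2 + |p w| / 2]. *)
Lemma net_bound n p (b d : R) : 0 < b -> (size p <= n.+1)%N ->
  8 * n%:R ^+ 2 * d <= b ->
  (forall t, 0 <= t <= b ->
     exists2 v, 0 <= v <= b & `|t - v| <= d /\ `|p.[v]| <= 2) ->
  forall t, 0 <= t <= b -> `|p.[t]| <= 4.
Proof.
move=> b0 szp db net.
have cont : {within `[0, b], continuous (fun t => `|p.[t]|)}.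
  apply: continuous_subspaceT => t.
  apply: continuous_comp; first exact: continuous_horner.
  exact: norm_continuous.
have [w wI wmax] := EVT_max (ltW b0) cont.
have pM t : 0 <= t <= b -> `|p.[t]| <= `|p.[w]|.
  by move=> tI; apply: wmax; rewrite in_itv.
suff : `|p.[w]| <= 4 by move=> h t /pM /le_trans; apply.
have wI' : 0 <= w <= b by move: wI; rewrite in_itv.
have [v vI [wv pv]] := net w wI'.
have lip : `|p.[w] - p.[v]| <= 4 * n%:R ^+ 2 / b * `|p.[w]| * `|w - v|.
  have key x y : 0 <= x <= b -> 0 <= y <= b -> x < y ->
      `|p.[y] - p.[x]| <= 4 * n%:R ^+ 2 / b * `|p.[w]| * `|y - x|.
    move=> xI yI xy; have [u uI ->] := @poly_mvt R x y p xy.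
    rewrite normrM ler_wpM2r // (markov b0 szp pM) //.
    by move: uI; rewrite in_itv /=; lra.
  case: (ltgtP w v) => [wv'|vw|->]; last by rewrite !subrr normr0 mulr0.
    by rewrite distrC (distrC w) key.
  exact: key.
have half : 4 * n%:R ^+ 2 / b * `|p.[w]| * `|w - v| <= `|p.[w]| / 2.
  rewrite mulrAC mulrC ler_wpM2l // mulrAC ler_pdivrMr //.
  have : n%:R ^+ 2 * `|w - v| <= n%:R ^+ 2 * d by rewrite ler_wpM2l // sqr_ge0.
  by lra.
have := ler_normD (p.[w] - p.[v]) p.[v]; rewrite subrK.
by lra.
Qed.

(** Domination by a geometric series of ratio at most [1 / 2]. *)
Lemma horner_geom q (C W t : R) : 0 <= t -> 0 <= W -> t * W <= 2^-1 ->
  (forall k, `|q`_k| <= C * W ^+ k) -> `|q.[t]| <= 2 * C.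
Proof.
move=> t0 W0 tW qk.
have C0 : 0 <= C by have := qk 0%N; rewrite expr0 mulr1; apply: le_trans.
have tW0 : 0 <= t * W by rewrite mulr_ge0.
rewrite horner_coef; apply: le_trans (ler_norm_sum _ _ _) _.
apply: (@le_trans _ _ (\sum_(i < size q) C * (2^-1) ^+ i)).
  apply: ler_sum => i _; rewrite normrM normrX (ger0_norm t0).
  apply: le_trans (ler_wpM2r (exprn_ge0 _ t0) (qk i)) _.
  by rewrite -mulrA -exprMn ler_wpM2l // (mulrC W) lerXn2r // nnegrE.
rewrite -mulr_sumr mulrC ler_wpM2r //.
have := @subrXX R 1 (2^-1) (size q).
under eq_bigr do rewrite expr1n mul1r.
rewrite expr1n; set s := \sum_(i < _) _.
have : 0 <= (2^-1 : R) ^+ size q by rewrite exprn_ge0.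
by lra.
Qed.

Lemma horner_tail m q (C W t : R) : 0 <= t -> 0 <= W -> t * W <= 2^-1 ->
  (forall k, `|q`_k| <= C * W ^+ k) ->
  `|q.[t] - \sum_(k < m) q`_k * t ^+ k| <= 2 * C * (t * W) ^+ m.
Proof.
move=> t0 W0 tW qk.
(* The tail starts at order [m], hence the factor [(t * W) ^+ m]. *)
have {1}-> : q = take_poly m q + drop_poly m q * 'X^m by rewrite poly_take_drop.
rewrite hornerD hornerM hornerXn.
have -> : (take_poly m q).[t] = \sum_(k < m) q`_k * t ^+ k.
  rewrite (horner_coef_wide _ (size_take_poly m q)).
  by apply: eq_bigr => i _; rewrite coef_take_poly ltn_ord.
rewrite addrAC subrr add0r normrM normrX (ger0_norm t0) exprMn.
rewrite [t ^+ m * _]mulrC mulrA ler_wpM2r ?exprn_ge0 // -mulrA.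
apply: (@horner_geom _ _ W) => // k; rewrite coef_drop_poly.
by rewrite -mulrA -exprD addnC.
Qed.

End DiscreteBound.

Section Roots.
Variables (R : realType) (mu : nat).
Hypothesis mu_gt0 : (0 < mu)%N.

(** The value [N^(-1/mu)]: the expansions in the theorem are polynomials
    evaluated at this point. *)
Definition invroot (N : nat) : R := (N%:R `^ (mu%:R^-1))^-1.
Local Notation z := invroot.

Lemma invroot_gt0 N : (0 < N)%N -> 0 < z N.
Proof. by move=> N0; rewrite invr_gt0 powR_gt0 // ltr0n. Qed.

Lemma invrootX N k : N%:R `^ (k%:R / mu%:R) = (z N ^+ k)^-1.
Proof. by rewrite mulrC powRrM powR_mulrn ?powR_ge0 // exprVn invrK. Qed.

Lemma invroot_mu N : (z N) ^+ mu = N%:R^-1.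
Proof.
rewrite -[LHS]invrK -invrootX divff ?pnatr_eq0 -?lt0n // powRr1 ?ler0n //.
Qed.

Lemma invroot_le1 N : (0 < N)%N -> z N <= 1.
Proof.
move=> N0; rewrite leNgt; apply/negP => z1.
have : 1 < z N ^+ mu by rewrite exprn_egt1 // -lt0n.
by rewrite invroot_mu ltNge invf_le1 ?ltr0n // ler1n N0.
Qed.

(** The points [N^(-1/mu)] below [b] leave gaps of length at most [b^2]:
    for [N] the integer following [t^(-mu)] one has
    [t / (1 + t) <= N^(-1/mu) <= t]. Near [t = 0] any large [N] will do. *)
Lemma invroot_net (t b : R) : 0 <= t <= b -> b <= 1 -> 0 < b ->
  exists2 N, (0 < N)%N & z N <= b /\ `|t - z N| <= b ^+ 2.
Proof.
move=> /andP[t0 tb] b1 b0.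
have small (x : R) : 0 < x -> exists2 N, (0 < N)%N & z N <= x /\ 
    (x <= 1 -> x <= z N * (1 + x)).
  move=> x0; have xm : 0 < x ^+ mu by rewrite exprn_gt0.
  pose N := (Num.trunc ((x ^+ mu)^-1)).+1.
  have i0 : 0 <= (x ^+ mu)^-1 by rewrite invr_ge0 ltW.
  have /andP[N1 N2] := truncn_itv i0.
  have N0 : 0 < N%:R :> R by rewrite ltr0n.
  have x0' := ltW x0; have z0' : 0 <= z N := ltW (invroot_gt0 (ltn0Sn _)).
  exists N => //; split=> [|x1].
    rewrite -(@ler_pXn2r _ mu) // invroot_mu.
    by rewrite -[leRHS]invrK lef_pV2 ?posrE ?invr_gt0 // ltW.
  rewrite -(@ler_pXn2r _ mu) // ?nnegrE ?mulr_ge0 ?addr_ge0 //.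
  rewrite exprMn invroot_mu mulrC ler_pdivlMr //.
  have -> : N%:R = (Num.trunc ((x ^+ mu)^-1))%:R + 1 :> R by rewrite natr1.
  apply: (@le_trans _ _ (1 + x)).
    rewrite mulrDr mulr1 lerD //; first by rewrite mulrC -ler_pdivlMr // div1r.
    by rewrite -[leRHS]expr1 ler_wiXn2l // ltW.
  by rewrite -[leLHS]expr1 ler_weXn2l // lerDl ltW.
case: (ltrP 0 t) => [{}t0|t0'].
  have [N N0 [zt tz]] := small t t0; exists N => //; split; first lra.
  have z0 := invroot_gt0 N0; have {}tz := tz (le_trans tb b1).
  by rewrite ger0_norm ?subr_ge0 // expr2; nra.
have -> : t = 0 by lra.
have [|N N0 [zt _]] := small (b ^+ 2); first by rewrite exprn_gt0.
exists N => //; have z0 := invroot_gt0 N0.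
split; last by rewrite sub0r normrN gtr0_norm.
by apply: le_trans zt _; rewrite expr2; nra.
Qed.

(** A polynomial of degree [n] bounded only at the points [N^(-1/mu) <= b] has
    coefficients bounded by powers of [n^2 / b]: this turns estimates on
    actual random matrices, which exist only for integral [N], into bounds on
    the coefficients of their asymptotic expansion. *)
Lemma coef_bound_of_net n (p : {poly R}) (b : R) : 0 < b -> b <= 1 ->
  (size p <= n.+1)%N -> 8 * n%:R ^+ 2 * b <= 1 ->
  (forall N, (0 < N)%N -> z N <= b -> `|p.[z N]| <= 2) ->
  forall k, `|p`_k| <= 4 * (4 * n%:R ^+ 2 / b) ^+ k.
Proof.
move=> b0 b1 szp nb pz k; rewrite [leRHS]mulrC.
apply: (markov_coef b0 szp) => t tI.
apply: (net_bound b0 szp (d := b ^+ 2)) t tI.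
  by rewrite (expr2 b) mulrA ger_pMl.
move=> t tI; have [N N0 [zb tz]] := invroot_net tI b1 b0.
exists (z N); first by rewrite zb ltW ?invroot_gt0.
by rewrite tz pz.
Qed.

End Roots.

(** * Separating polynomials and coefficient majorants *)

Section Majorant.
Variable R : realType.
Implicit Types (p q : {poly R}) (r : R).

(** If a linear functional [u] satisfies [|u(x^j)| <= B r^j] for all [j], then
    [|u(p(x))| <= B * maj p r]; it is submultiplicative in [p], so powers
    of a fixed polynomial with small majorant are exponentially small. *)
Definition maj p r : R := \sum_(j < size p) `|p`_j| * r ^+ j.

Lemma maj_wide n p r : (size p <= n)%N ->
  maj p r = \sum_(j < n) `|p`_j| * r ^+ j.
Proof.
move=> szp; rewrite /maj (big_ord_widen n (fun j => `|p`_j| * r ^+ j)) //.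
rewrite big_mkcond; apply: eq_bigr => i _.
by case: ltnP => // /(nth_default 0) ->; rewrite normr0 mul0r.
Qed.

Lemma maj_ge0 p r : 0 <= r -> 0 <= maj p r.
Proof. by move=> r0; apply: sumr_ge0 => i _; rewrite mulr_ge0 ?exprn_ge0. Qed.

Lemma maj0 r : maj 0 r = 0.
Proof. by rewrite /maj size_poly0 big_ord0. Qed.

Lemma maj1 r : maj 1 r = 1.
Proof. by rewrite /maj size_poly1 big_ord1 coefC normr1 mul1r. Qed.

Lemma majN p r : maj (- p) r = maj p r.
Proof.
by rewrite /maj size_polyN; apply: eq_bigr => i _; rewrite coefN normrN.
Qed.

Lemma majD p q r : 0 <= r -> maj (p + q) r <= maj p r + maj q r.
Proof.
move=> r0; have n_p := leq_maxl (size p) (size q).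
have n_q := leq_maxr (size p) (size q).
rewrite (maj_wide _ (size_polyD p q)) (maj_wide _ n_p) (maj_wide _ n_q).
rewrite -big_split; apply: ler_sum => i _ /=.
by rewrite -mulrDl coefD ler_wpM2r ?exprn_ge0 // ler_normD.
Qed.

Lemma majZ (c : R) p r : maj (c *: p) r = `|c| * maj p r.
Proof.
rewrite (maj_wide _ (size_scale_leq c p)) mulr_sumr.
by apply: eq_bigr => i _; rewrite coefZ normrM mulrA.
Qed.

Lemma majXM p r : maj ('X * p) r = r * maj p r.
Proof.
have szX : (size ('X * p)%R <= (size p).+1)%N.
  by apply: leq_trans (size_polyMleq _ _) _; rewrite size_polyX.
rewrite (maj_wide _ szX) big_ord_recl coefXM normr0 mul0r add0r mulr_sumr.
by apply: eq_bigr => i _; rewrite coefXM /= exprS mulrCA.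
Qed.

Lemma majXnM n p r : maj ('X^n * p) r = r ^+ n * maj p r.
Proof.
by elim: n => [|n IH]; rewrite ?mul1r // !exprS -mulrA majXM IH mulrA.
Qed.

Lemma majM p q r : 0 <= r -> maj (p * q) r <= maj p r * maj q r.
Proof.
move=> r0.
have -> : p * q = \sum_(j < size p) p`_j *: ('X^j * q).
  rewrite -{1}(coefK p) poly_def mulr_suml.
  by apply: eq_bigr => j _; rewrite scalerAl.
rewrite [maj p r]/maj mulr_suml.
apply: (big_ind2 (fun x y => maj x r <= y)) => [|x y x' y' IH IH'|j _].
- by rewrite maj0.
- by apply: le_trans (majD _ _ r0) _; rewrite lerD.
- by rewrite majZ majXnM mulrA.
Qed.

Lemma majX p n r : 0 <= r -> maj (p ^+ n) r <= maj p r ^+ n.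
Proof.
move=> r0; elim: n => [|n IH]; first by rewrite maj1.
rewrite !exprS; apply: le_trans (majM _ _ r0) _.
by rewrite ler_wpM2l ?maj_ge0.
Qed.

Lemma bernoulli (x : R) n : -1 <= x -> 1 + n%:R * x <= (1 + x) ^+ n.
Proof.
move=> x1; elim: n => [|n IH]; first by rewrite mul0r addr0.
have x0 : 0 <= 1 + x by lra.
rewrite exprS; apply: le_trans (ler_wpM2l x0 IH); rewrite -natr1.
have : 0 <= n%:R * x ^+ 2 by rewrite mulr_ge0 // sqr_ge0.
by lra.
Qed.

(** The coefficients of [1 - (1 - w)^n] are dominated by those of
    [(1 + |w|)^n - 1]; by induction from
    [1 - (1-w)^(n+1) = (1 - (1-w)^n) + w (1-w)^n]. *)
Lemma maj_one_sub_pow w n r : 0 <= r ->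
  maj (1 - (1 - w) ^+ n) r <= (1 + maj w r) ^+ n - 1.
Proof.
move=> r0; elim: n => [|n IH]; first by rewrite !expr0 !subrr maj0.
have -> : 1 - (1 - w) ^+ n.+1 = (1 - (1 - w) ^+ n) + w * (1 - w) ^+ n.
  by rewrite exprS; ring.
apply: le_trans (majD _ _ r0) _; apply: le_trans (lerD IH (majM _ _ r0)) _.
have : maj ((1 - w) ^+ n) r <= (1 + maj w r) ^+ n.
  apply: le_trans (majX _ _ r0) _; rewrite lerXn2r ?nnegrE ?maj_ge0 //.
    by rewrite addr_ge0 ?maj_ge0.
  by apply: le_trans (majD _ _ r0) _; rewrite maj1 majN.
have := maj_ge0 w r0; rewrite exprS; nra.
Qed.

Lemma exists_pow_lt (q d : R) : 0 <= q < 1 -> 0 < d ->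
  exists2 n, (0 < n)%N & q ^+ n <= d.
Proof.
move=> /andP[q0 q1] d0; have nq : `|q| < 1 by rewrite ger0_norm.
have /cvgrPdist_lt/(_ d d0)[n _ nP] := cvg_expr nq.
exists n.+1 => //; have := nP n.+1 (leqnSn n).
by rewrite /= sub0r normrN ger0_norm ?exprn_ge0 // => /ltW.
Qed.

(** The test polynomial is [f(t) = 1 - (1 - (t/A)^P)^n] with
    [n] about [T (A/r2)^P]. For [t >= r2] the number [n (t/A)^P] is at least
    [T], so [(1 - (t/A)^P)^n <= 1 / (1 + T)] is small; while at [r1] the
    majorant is governed by [n (r1/A)^P], about [T (r1/r2)^P], which is as
    small as desired once [P] is large. *)
Lemma sep_poly (A r1 r2 k th : R) : 0 < r1 -> r1 < r2 -> r2 <= A ->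
  k < 1 -> 0 < th ->
  exists f : {poly R}, [/\ f`_0 = 0,
    forall t, 0 <= t <= A -> 0 <= f.[t] <= 1,
    forall t, r2 <= t <= A -> k <= f.[t] & maj f r1 <= th].
Proof.
move=> r1_0 r12 r2A k1 th0.
have r20 : 0 < r2 by apply: lt_trans r12.
have A0 : 0 < A by apply: lt_le_trans r2A.
pose T := (1 - k)^-1; have T0 : 0 < T by rewrite invr_gt0 subr_gt0.
pose d := Num.min (2^-1) (th / 2).
have d0 : 0 < d by rewrite lt_min invr_gt0 ltr0n divr_gt0.
have q01 : 0 <= r1 / r2 < 1.
  by rewrite ltr_pdivrMr // mul1r r12 andbT divr_ge0 // ltW.
have [P P0 Pq] := exists_pow_lt q01 (divr_gt0 d0 (addr_gt0 T0 ltr01)).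
have u0 : 0 < (r2 / A) ^+ P by rewrite exprn_gt0 // divr_gt0.
pose n := (Num.trunc (T / (r2 / A) ^+ P)).+1.
have /andP[n1 n2] := truncn_itv (ltW (divr_gt0 T0 u0)).
have nT : T <= n%:R * (r2 / A) ^+ P by rewrite -ler_pdivrMr // ltW.
have nd : n%:R * (r1 / A) ^+ P <= d.
  have e : (r1 / A) ^+ P = (r1 / r2) ^+ P * (r2 / A) ^+ P.
    by rewrite -exprMn mulrA divfK // gt_eqF.
  have nT' : n%:R * (r2 / A) ^+ P <= T + 1.
    rewrite -natr1 mulrDl mul1r lerD //; first by rewrite -ler_pdivlMr.
    apply: exprn_ile1; first by rewrite divr_ge0 // ltW.
    by rewrite ler_pdivrMr // mul1r.
  rewrite e mulrCA -(divfK (lt0r_neq0 (addr_gt0 T0 ltr01)) d).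
  apply: ler_pM Pq nT'; first by rewrite exprn_ge0 //; case/andP: q01.
  by rewrite mulr_ge0 ?ler0n // ltW.
pose w := (A ^- P) *: 'X^P : {poly R}.
have wE t : w.[t] = (t / A) ^+ P.
  by rewrite hornerZ hornerXn exprMn exprVn mulrC.
have fE t : (1 - (1 - w) ^+ n).[t] = 1 - (1 - (t / A) ^+ P) ^+ n.
  by rewrite hornerD hornerN horner_exp hornerD hornerN wE hornerC.
have w01 t : 0 <= t <= A -> 0 <= (t / A) ^+ P <= 1.
  move=> /andP[t0 tA]; have tA0 : 0 <= t / A by rewrite divr_ge0 // ltW.
  by rewrite exprn_ge0 //= exprn_ile1 // ler_pdivrMr // mul1r.
exists (1 - (1 - w) ^+ n); split.
- rewrite -horner_coef0 fE mul0r expr0n gtn_eqF // subr0 expr1n subrr //.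
- move=> t /w01 tA; rewrite fE; have h0 : 0 <= 1 - (t / A) ^+ P by lra.
  have h1 : 1 - (t / A) ^+ P <= 1 by lra.
  by have := exprn_ge0 n h0; have := exprn_ile1 n h0 h1; lra.
- move=> t /andP[r2t tA]; have t0 : 0 <= t by apply: le_trans r2t; apply: ltW.
  rewrite fE; set v := (t / A) ^+ P.
  have /andP[v0 v1] : 0 <= v <= 1 by rewrite w01 // t0.
  have uv : (r2 / A) ^+ P <= v.
    rewrite lerXn2r ?nnegrE ?divr_ge0 // ?(ltW A0) ?(ltW r20) //.
    by rewrite ler_wpM2r // invr_ge0 ltW.
  have b1 : 1 + n%:R * v <= (1 + v) ^+ n by apply: bernoulli; lra.
  have Tv : T <= (1 + v) ^+ n.
    apply: le_trans b1; apply: le_trans nT _.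
    have : n%:R * (r2 / A) ^+ P <= n%:R * v by rewrite ler_wpM2l // ler0n.
    by lra.
  have p1 : (1 + v) ^+ n * (1 - v) ^+ n <= 1.
    rewrite -exprMn; apply: exprn_ile1; nra.
  have v'0 : 0 <= (1 - v) ^+ n by rewrite exprn_ge0 // subr_ge0.
  have : T * (1 - v) ^+ n <= 1 by apply: le_trans p1; rewrite ler_wpM2r.
  rewrite /T ler_pdivrMl ?subr_gt0 //; lra.
- apply: le_trans (maj_one_sub_pow _ _ (ltW r1_0)) _.
  have -> : maj w r1 = (r1 / A) ^+ P.
    rewrite majZ -['X^P]mulr1 majXnM maj1 mulr1 normfV ger0_norm.
      by rewrite exprMn exprVn mulrC.
    by rewrite exprn_ge0 // ltW.
  set v := (r1 / A) ^+ P in nd *.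
  have v0 : 0 <= v by rewrite exprn_ge0 // divr_ge0 // ltW.
  have d2 : d <= 2^-1 by rewrite ge_min lexx.
  have dth : d <= th / 2 by rewrite ge_min lexx orbT.
  have n_ge1 : (1 : R) <= n%:R by rewrite ler1n.
  have v1 : v <= 1 by nra.
  have b1 : 1 + n%:R * (- v) <= (1 + - v) ^+ n by apply: bernoulli; lra.
  have p1 : (1 + v) ^+ n * (1 - v) ^+ n <= 1.
    rewrite -exprMn; apply: exprn_ile1; nra.
  have p0 : 0 <= (1 + v) ^+ n by rewrite exprn_ge0 // addr_ge0.
  nra.
Qed.

(** With [y = q^(1/(d+1))], Bernoulli bounds [m y^m], and
    [m^d q^m = (m y^m)^d y^m]. *)
Lemma cvg_poly_exp (q : R) d : 0 <= q < 1 ->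
  (fun m : nat => m%:R ^+ d * q ^+ m) @ \oo --> (0 : R).
Proof.
move=> /andP[q0 q1].
have [->|qn0] := eqVneq q 0.
  apply/cvgrPdist_lt => e e0; near=> m.
  rewrite expr0n gtn_eqF; first by rewrite mulr0 subrr normr0.
  by near: m; exists 1%N.
have {qn0}q0 : 0 < q by rewrite lt_neqAle eq_sym qn0.
pose y := q `^ (d.+1%:R^-1).
have y0 : 0 < y by rewrite powR_gt0.
have yq : y ^+ d.+1 = q.
  by rewrite -powR_mulrn ?powR_ge0 // -powRrM mulVf ?pnatr_eq0 // powRr1 // ltW.
have y1 : y < 1.
  rewrite ltNge; apply/negP => /(exprn_ege1 d.+1); rewrite yq; lra.
pose B := (y^-1 - 1)^-1.
have yi : 1 < y^-1 by rewrite invf_gt1.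
have B0 : 0 < B by rewrite invr_gt0 subr_gt0.
have my m : m%:R * y ^+ m <= B.
  have := @bernoulli (y^-1 - 1) m; rewrite (addrC 1 (y^-1 - 1)) subrK exprVn.
  have ym : 0 < y ^+ m by rewrite exprn_gt0.
  move=> h; rewrite -ler_pdivlMr // /B mulrC ler_pdivlMr ?subr_gt0 //.
  by apply: le_trans (h _); [rewrite lerDr | lra].
have ny : `|y| < 1 by rewrite gtr0_norm.
have c0 : (fun m => B ^+ d * y ^+ m) @ \oo --> (0 : R).
  by rewrite -(mulr0 (B ^+ d)); apply: cvgMr; exact: cvg_expr.
apply: (@squeeze_cvgr _ _ _ _ (fun=> 0) (fun m => B ^+ d * y ^+ m)) c0 => //.
  apply: nearW => m; rewrite mulr_ge0 ?exprn_ge0 ?(ltW q0) //=.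
  rewrite -[in q ^+ m]yq -exprM mulnC exprM exprSr mulrA ler_wpM2r //.
    by rewrite exprn_ge0 // ltW.
  by rewrite -exprMn lerXn2r // nnegrE ?(ltW B0) // mulr_ge0 // exprn_ge0 // ltW.
exact: cvg_cst.
Unshelve. all: by end_near. Qed.

End Majorant.

(** * Bounds on the expansion of polynomial statistics *)

Section Pairing.
Variable R : realType.

(** The functional that sends the monomial [X^j] to [al j]; applied to moments
    it evaluates the statistic [h]. *)
Definition pairing (al : nat -> R) (h : {poly R}) : R :=
  \sum_(j < size h) h`_j * al j.

Lemma pairing_le (al : nat -> R) (h : {poly R}) (B r : R) :
  (forall j, (j < size h)%N -> `|al j| <= B * r ^+ j) ->
  `|pairing al h| <= B * maj h r.
Proof.
move=> alB; apply: le_trans (ler_norm_sum _ _ _) _; rewrite mulr_sumr.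
apply: ler_sum => j _; rewrite normrM mulrCA ler_wpM2l //.
exact: alB.
Qed.

End Pairing.

Section Expansion.
Variables (R : realType) (mu K c : nat) (L B r1 : R).
Variables (a e : nat -> nat -> R).
Local Notation z := (invroot R mu).

Hypothesis mu_gt0 : (0 < mu)%N.
Hypothesis c_gt0 : (0 < c)%N.
Hypothesis expand : forall j s N, (0 < s)%N -> (j * K <= s)%N ->
  (c * s ^ c <= N)%N ->
  `|e N j - \sum_(k < s) a k j * z N ^+ k| <=
  L ^+ j * ((c * s)%:R ^+ (c * s) * z N ^+ s).
Hypothesis low_terms : forall k j, (k <= mu)%N -> `|a k j| <= B * r1 ^+ j.

(** The ratio [4 s^2 / b] of the coefficient bound, where [1 / b] is
    [8 s^2 Ls (c s)^c]. It is polynomial in [s], which is what matters: the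
    error terms [(c s)^(c s)] of the expansion grow much faster. *)
Definition coef_scale (Ls : R) (s : nat) : R :=
  32 * Ls * s%:R ^+ 4 * (c * s)%:R ^+ c.

(** The expansion truncated at order [s], where [s] exceeds the degree of [h]
    times the word length, is a polynomial [P] in [N^(-1/mu)]. Since the
    statistic of [h] is at most [1] for every [N], [P] is at most [2] at all
    [N^(-1/mu) <= b], hence its [k]-th coefficient is at most
    [4 (coef_scale s)^k]. So the terms of order above [mu] add up to a
    geometric series, while the lower ones are controlled by the majorant. *)
Lemma pairing_expansion (Ls : R) s (h : {poly R}) N : 1 <= Ls -> (mu < s)%N ->
  (forall j, (j < size h)%N -> (j * K <= s)%N) -> maj h L <= Ls ^+ s ->
  (forall N', (0 < N')%N -> `|pairing (e N') h| <= 1) ->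
  (0 < N)%N -> z N * coef_scale Ls s <= 2^-1 ->
  pairing (e N) h <=
    mu.+1%:R * (B * maj h r1) + 9 * (z N * coef_scale Ls s) ^+ mu.+1.
Proof.
move=> Ls1 mu_s hK hL e1 N0 zW.
have s0 : (0 < s)%N by apply: leq_ltn_trans mu_s.
set W := coef_scale Ls s in zW *.
pose X : R := (c * s)%:R ^+ c.
have X1 : 1 <= X by rewrite exprn_ege1 // ler1n muln_gt0 c_gt0.
have sR : (1 : R) <= s%:R by rewrite ler1n.
have s2 : (1 : R) <= s%:R ^+ 2 by rewrite exprn_ege1.
have LX1 : 1 <= Ls * X by rewrite mulr_ege1.
have D1 : 1 <= s%:R ^+ 2 * (Ls * X) by rewrite mulr_ege1.
pose b : R := (8 * s%:R ^+ 2 * (Ls * X))^-1.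
have D0 : 0 < 8 * s%:R ^+ 2 * (Ls * X) by lra.
have b0 : 0 < b by rewrite invr_gt0.
have bLX : b * (Ls * X) <= 1.
  by rewrite /b mulrC ler_pdivrMr // mul1r; nra.
have b1 : b <= 1 by apply: le_trans bLX; rewrite ler_peMr // ltW.
have sb : 8 * s%:R ^+ 2 * b <= 1.
  by rewrite /b ler_pdivrMr // mul1r ler_peMr //; lra.
have WE : W = 4 * s%:R ^+ 2 / b.
  by rewrite /b invrK /W /coef_scale -/X; ring.
pose P := \poly_(k < s) pairing (a k) h.
have szP : (size P <= s.+1)%N by apply: leq_trans (size_poly _ _) _.
have PE t : P.[t] = \sum_(j < size h) h`_j * \sum_(k < s) a k j * t ^+ k.
  rewrite horner_poly.
  under eq_bigr => k _ do rewrite /pairing mulr_suml.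
  rewrite exchange_big; apply: eq_bigr => j _; rewrite mulr_sumr.
  by apply: eq_bigr => k _; rewrite mulrA.
have err N' : (0 < N')%N -> z N' <= b ->
    `|pairing (e N') h - P.[z N']| <= (Ls * X * z N') ^+ s.
  move=> N'0 zb; have z0 := invroot_gt0 R mu N'0.
  have big : (c * s ^ c <= N')%N.
    apply: (@leq_trans ((c * s) ^ c)%N).
      by rewrite expnMn leq_mul2r -[X in (X <= _)%N]expn1 leq_pexp2l ?orbT.
    rewrite -(ler_nat R) natrX -/X -[leRHS]invrK -(invroot_mu R mu_gt0) -[leLHS]invrK.
    have X0 : 0 < X by lra.
    rewrite lef_pV2 ?posrE ?invr_gt0 ?(exprn_gt0 mu z0) //.
    apply: (@le_trans _ _ b).
      apply: le_trans zb; rewrite -[leRHS]expr1.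
      by rewrite ler_wiXn2l ?(ltW z0) ?invroot_le1.
    rewrite -div1r ler_pdivlMr; last by lra.
    by apply: le_trans bLX; rewrite ler_wpM2l ?(ltW b0) // ler_peMl //; lra.
  rewrite PE -sumrB.
  have -> : \sum_(j < size h) (h`_j * e N' j -
      h`_j * \sum_(k < s) a k j * z N' ^+ k) =
      pairing (fun j => e N' j - \sum_(k < s) a k j * z N' ^+ k) h.
    by apply: eq_bigr => j _; rewrite mulrBr.
  apply: le_trans (pairing_le (r := L)
    (B := (c * s)%:R ^+ (c * s) * z N' ^+ s) _) _.
    by move=> j jh; rewrite [leRHS]mulrC; apply: expand => //; apply: hK.
  rewrite mulrC exprM -/X -exprMn -[Ls * X * _]mulrA [leRHS]exprMn.
  rewrite ler_wpM2r // exprn_ge0 //.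
  by rewrite mulr_ge0 ?(ltW z0) //; lra.
have PW k : `|P`_k| <= 4 * W ^+ k.
  rewrite WE; apply: (coef_bound_of_net mu_gt0 b0 b1 szP sb) => N' N'0 zb.
  have z0 := invroot_gt0 R mu N'0.
  have e2 : `|pairing (e N') h - P.[z N']| <= 1.
    apply: le_trans (err N' N'0 zb) _; apply: exprn_ile1; nra.
  have := ler_normB (pairing (e N') h) (pairing (e N') h - P.[z N']).
  by rewrite subKr; have := e1 N' N'0; lra.
have z0 := invroot_gt0 R mu N0.
have W0 : 0 <= W by rewrite WE !mulr_ge0 ?invr_ge0 ?(ltW b0) //; lra.
have zb : z N <= b.
  move: zW; rewrite WE mulrA ler_pdivrMr //; nra.
have zW0 : 0 <= z N * W by rewrite mulr_ge0 // ltW.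
have tail := horner_tail mu.+1 (ltW z0) W0 zW PW.
have low : `|\sum_(k < mu.+1) P`_k * z N ^+ k| <= mu.+1%:R * (B * maj h r1).
  apply: le_trans (ler_norm_sum _ _ _) _.
  rewrite -[X in X%:R * _]card_ord -sum1_card natr_sum mulr_suml.
  apply: ler_sum => k _; rewrite mul1r normrM coef_poly.
  have ks : (k < s)%N by apply: leq_ltn_trans mu_s; rewrite -ltnS.
  have ak : `|pairing (a k) h| <= B * maj h r1.
    by apply: pairing_le => j _; apply: low_terms; rewrite -ltnS.
  rewrite ks; apply: le_trans ak; rewrite ler_piMr // normrX gtr0_norm //.
  by apply: exprn_ile1; [exact: ltW | exact: invroot_le1].
have ez : (Ls * X * z N) ^+ s <= (z N * W) ^+ mu.+1.
  apply: (@le_trans _ _ ((z N * W) ^+ s)).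
    rewrite lerXn2r ?nnegrE // ?mulr_ge0 ?(ltW z0) //; try lra.
    rewrite mulrC ler_wpM2l ?(ltW z0) // WE /b invrK; nra.
  by rewrite ler_wiXn2l //; lra.
have := err N N0 zb.
rewrite !ler_norml in tail low *; lra.
Qed.

End Expansion.

(** * The bad event becomes rare *)

Section Concentration.
Variables (R : realType) (mu K c : nat) (L B r1 r2 A : R).
Variables (a e : nat -> nat -> R) (bad : nat -> R).
Local Notation z := (invroot R mu).

Hypothesis mu_gt0 : (0 < mu)%N.
Hypothesis c_gt0 : (0 < c)%N.
Hypothesis L_ge0 : 0 <= L.
Hypothesis B_ge0 : 0 <= B.
Hypotheses (r1_gt0 : 0 < r1) (r12 : r1 < r2) (r2A : r2 <= A).
Hypothesis expand : forall j s N, (0 < s)%N -> (j * K <= s)%N ->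
  (c * s ^ c <= N)%N ->
  `|e N j - \sum_(k < s) a k j * z N ^+ k| <=
  L ^+ j * ((c * s)%:R ^+ (c * s) * z N ^+ s).
Hypothesis low_terms : forall k j, (k <= mu)%N -> `|a k j| <= B * r1 ^+ j.
Hypothesis pairing_bounded : forall N (h : {poly R}), (0 < N)%N -> h`_0 = 0 ->
  (forall t, 0 <= t <= A -> 0 <= h.[t] <= 1) -> `|pairing (e N) h| <= 1.
Hypothesis bad_ge0 : forall N, 0 <= bad N.
Hypothesis bad_markov : forall N (h : {poly R}) k, (0 < N)%N -> h`_0 = 0 ->
  (forall t, 0 <= t <= A -> 0 <= h.[t] <= 1) ->
  (forall t, r2 <= t <= A -> k <= h.[t]) ->
  bad N * k <= N%:R * pairing (e N) h.

(** Take [h = f^m] with [f] a fixed separating polynomial and [m] the integer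
    part of [log2 N]. Then [h >= k^m] on the bad event, the terms of order at
    most [mu] contribute [N * 16^(-m)], and those of higher order contribute
    [N * N^(-(mu+1)/mu) = N^(-1/mu)] up to a power of [m]. Since
    [k > 2^(-1/mu)], dividing by [k^m] leaves both negligible. *)
Theorem bad_cvg0 : bad @ \oo --> (0 : R).
Proof.
pose g := z 2.
have g0 : 0 < g by apply: invroot_gt0.
have gmu : g ^+ mu = 2^-1 by rewrite /g invroot_mu.
have g1 : g < 1.
  rewrite ltNge; apply/negP => /(exprn_ege1 mu); rewrite gmu; lra.
(* Any [k] strictly between [2^(-1/mu)] and [1] would do. *)
pose k : R := (1 + g) / 2.
have k1 : k < 1 by rewrite /k; lra.
have k_half : 2^-1 <= k by rewrite /k; lra.
have k0 : 0 < k by rewrite /k; lra.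
have gk : g < k by rewrite /k; lra.
have [|f [f0 f01 fk fth]] := @sep_poly R A r1 r2 k (16^-1) r1_gt0 r12 r2A k1.
  by rewrite invr_gt0.
(* The order [D * m] exceeds both [mu] and the word length of [f ^+ m]. *)
pose D := (size f * K + mu.+1)%N.
have D0 : (0 < D)%N by rewrite /D addnS.
pose Ls := 1 + maj f L.
have Ls1 : 1 <= Ls by rewrite lerDl maj_ge0.
pose W m := coef_scale c Ls (D * m).
pose Cst := 32 * Ls * D%:R ^+ 4 * (c * D)%:R ^+ c.
have WE m : W m = Cst * m%:R ^+ (c + 4).
  rewrite /W /coef_scale /Cst mulnA !natrM !exprMn (exprD m%:R c 4).
  move: (m%:R ^+ c) (m%:R ^+ 4) (D%:R ^+ 4) (c%:R ^+ c) (D%:R ^+ c) => x1 x2 x3 x4 x5.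
  by ring.
have Cst0 : 0 <= Cst by rewrite !mulr_ge0 ?exprn_ge0 ?ler0n //; lra.
have W0 m : 0 <= W m by rewrite WE mulr_ge0 ?exprn_ge0.
pose F m : R := 2 * mu.+1%:R * B * 4^-1 ^+ m +
  9 * (Cst ^+ mu.+1 * (m%:R ^+ ((c + 4) * mu.+1) * (g / k) ^+ m)).
have F0 : F @ \oo --> (0 : R).
  have -> : 0 = 2 * mu.+1%:R * B * 0 + 9 * (Cst ^+ mu.+1 * 0) :> R.
    by rewrite !mulr0 addr0.
  apply: cvgD; first by apply: cvgMr; apply: cvg_expr; rewrite ger0_norm; lra.
  do 2![apply: cvgMr]; apply: cvg_poly_exp.
  by rewrite divr_ge0 ?(ltW g0) ?(ltW k0) //= ltr_pdivrMr // mul1r.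
have G0 : (fun m => Cst * (m%:R ^+ (c + 4) * g ^+ m)) @ \oo --> (0 : R).
  rewrite -(mulr0 Cst); apply: cvgMr; apply: cvg_poly_exp.
  by rewrite (ltW g0).
have zg N : (0 < N)%N -> z N <= g ^+ trunc_log 2 N.
  move=> N0; have z0 := invroot_gt0 R mu N0.
  rewrite -(@ler_pXn2r _ mu) // ?nnegrE ?(ltW z0) ?exprn_ge0 ?(ltW g0) //.
  rewrite invroot_mu // exprAC gmu exprVn lef_pV2 ?posrE ?exprn_gt0 ?ltr0n //.
  by rewrite -natrX ler_nat trunc_logP.
have main N : (0 < N)%N -> (0 < trunc_log 2 N)%N ->
    Cst * ((trunc_log 2 N)%:R ^+ (c + 4) * g ^+ trunc_log 2 N) <= 2^-1 ->
    bad N <= F (trunc_log 2 N).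
  move=> N0; have := zg N N0; have := trunc_log_ltn N (isT : 1 < 2)%N.
  move: (trunc_log 2 N) => m Nm zgm m0 small.
  have z0 := invroot_gt0 R mu N0.
  have N0R : 0 < N%:R :> R by rewrite ltr0n.
  have gm0 : 0 < g ^+ m by rewrite exprn_gt0.
  have km0 : 0 < k ^+ m by rewrite exprn_gt0.
  have szfm : (size (f ^+ m) <= ((size f).-1 * m).+1)%N.
    exact: size_poly_exp_leq.
  have fm0 : (f ^+ m)`_0 = 0.
    by rewrite -horner_coef0 horner_exp horner_coef0 f0 expr0n gtn_eqF.
  have fm01 t : 0 <= t <= A -> 0 <= (f ^+ m).[t] <= 1.
    by move=> /f01 /andP[h0 h1]; rewrite horner_exp exprn_ge0 // exprn_ile1.
  have fmk t : r2 <= t <= A -> k ^+ m <= (f ^+ m).[t].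
    move=> /fk h; rewrite horner_exp lerXn2r // nnegrE ?(ltW k0) //.
    by apply: le_trans h; apply: ltW.
  have zW : z N * W m <= 2^-1.
    apply: le_trans small; rewrite WE mulrC -mulrA.
    by rewrite ler_wpM2l // ler_wpM2l ?exprn_ge0.
  have pe : pairing (e N) (f ^+ m) <=
      mu.+1%:R * (B * maj (f ^+ m) r1) + 9 * (z N * W m) ^+ mu.+1.
    apply: (pairing_expansion mu_gt0 c_gt0 expand low_terms (Ls := Ls)
      (s := (D * m)%N)) => //.
    - by apply: (@leq_trans D); [rewrite /D addnS ltnS leq_addl | rewrite leq_pmulr].
    - move=> j jh; have jm : (j <= size f * m)%N.
        have : (j < ((size f).-1 * m).+1)%N by apply: leq_trans szfm.
        by rewrite ltnS => /leq_trans; apply; rewrite leq_mul2r leq_pred orbT.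
      apply: (@leq_trans (size f * m * K)); first by rewrite leq_mul2r jm orbT.
      by rewrite mulnAC leq_mul2r /D leq_addr orbT.
    - apply: le_trans (majX _ _ L_ge0) _.
      apply: (@le_trans _ _ (Ls ^+ m)).
        by rewrite lerXn2r ?nnegrE ?maj_ge0 //; [lra | rewrite /Ls lerDr].
      by rewrite ler_weXn2l // leq_pmull.
    - by move=> N' N'0; apply: pairing_bounded.
  have := bad_markov N0 fm0 fm01 fmk.
  rewrite -ler_pdivlMr // => /le_trans; apply.
  rewrite ler_pdivrMr //.
  apply: le_trans (ler_wpM2l (ltW N0R) pe) _.
  rewrite [leLHS]mulrDr /F [leRHS]mulrDl; apply: lerD.
    have fr : maj (f ^+ m) r1 <= 16^-1 ^+ m.
      apply: le_trans (majX _ _ (ltW r1_gt0)) _.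
      by rewrite lerXn2r ?nnegrE ?maj_ge0 // ltW.
    have N2 : N%:R <= 2 * 2 ^+ m :> R.
      by rewrite -exprS -natrX ler_nat ltnW.
    have e16 : 2 * 2 ^+ m * 16^-1 ^+ m <= 2 * 4^-1 ^+ m * k ^+ m :> R.
      rewrite -!mulrA ler_wpM2l // -!exprMn.
      by apply: lerXn2r; rewrite ?nnegrE; lra.
    have -> : 2 * mu.+1%:R * B * 4^-1 ^+ m * k ^+ m =
       (mu.+1%:R * B) * (2 * 4^-1 ^+ m * k ^+ m) by ring.
    have -> : N%:R * (mu.+1%:R * (B * maj (f ^+ m) r1)) =
       (mu.+1%:R * B) * (N%:R * maj (f ^+ m) r1) by ring.
    rewrite ler_wpM2l ?mulr_ge0 //; apply: le_trans e16.
    by apply: ler_pM => //; rewrite maj_ge0 // ltW.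
  (* The factor [N] is absorbed by [mu] of the [mu + 1] factors [z N]. *)
  have Nz : N%:R * z N ^+ mu.+1 = z N.
    by rewrite exprSr invroot_mu // mulrA divff ?mul1r // gt_eqF.
  have -> : N%:R * (9 * (z N * W m) ^+ mu.+1) = 9 * (z N * W m ^+ mu.+1).
    by rewrite -{2}Nz exprMn; ring.
  rewrite -!mulrA ler_wpM2l // expr_div_n divfK ?gt_eqF //.
  by rewrite WE exprMn -exprM mulrC -mulrA !ler_wpM2l ?exprn_ge0.
have Mto N M : (2 ^ M <= N)%N -> (M <= trunc_log 2 N)%N.
  by move=> h; apply: trunc_log_max.
apply/cvgrPdist_le => eps eps0.
have half0 : 0 < 2^-1 :> R by rewrite invr_gt0.
have /cvgrPdist_le/(_ eps eps0)[M1 _ F1] := F0.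
have /cvgrPdist_le/(_ _ half0)[M2 _ G2] := G0.
exists (2 ^ (M1 + M2 + 1))%N => // N /= NM.
have N0 : (0 < N)%N by apply: leq_trans NM; rewrite expn_gt0.
have [t0 t1 t2] : [/\ 0 < trunc_log 2 N, M1 <= trunc_log 2 N &
    M2 <= trunc_log 2 N]%N.
  by move: (Mto _ _ NM); move: (trunc_log 2 N) => t; clear; split; lia.
have := F1 _ t1; have := G2 _ t2; rewrite /= !sub0r !normrN => g2 f1.
rewrite ger0_norm //; apply: le_trans (main N N0 t0 _) _.
  exact: le_trans (ler_norm _) g2.
exact: le_trans (ler_norm _) f1.
Qed.

End Concentration.

(** * The group algebra and the regular representation *)

Section ComplexModulus.
Variable R : realType.
Implicit Types x y : R[i].

Lemma normc_ge0 x : 0 <= normc x.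
Proof. by case: x => a b /=; exact: sqrtr_ge0. Qed.

Lemma normc_sqr x : normc x ^+ 2 = complex.Re x ^+ 2 + complex.Im x ^+ 2.
Proof. by case: x => a b /=; rewrite sqr_sqrtr ?addr_ge0 ?sqr_ge0. Qed.

Lemma normc_conj x : normc x^* = normc x.
Proof. by case: x => a b /=; rewrite sqrrN. Qed.

Lemma normc_real (r : R) : normc r%:C = `|r|.
Proof. by rewrite /= expr0n /= addr0 sqrtr_sqr. Qed.

Lemma conjM_normc x : x^* * x = (normc x ^+ 2)%:C.
Proof.
rewrite normc_sqr; case: x => a b; apply/eqP; rewrite eq_complex /=.
by apply/andP; split; apply/eqP; ring.
Qed.

Lemma Re_le_normc x : `|complex.Re x| <= normc x.
Proof.
case: x => a b /=; rewrite -sqrtr_sqr; apply: ler_wsqrtr.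
by rewrite lerDl sqr_ge0.
Qed.

Lemma normc_sum (I : Type) (r : seq I) (P : pred I) (F : I -> R[i]) :
  normc (\sum_(i <- r | P i) F i) <= \sum_(i <- r | P i) normc (F i).
Proof.
elim/big_ind2 : _ => [|x a y b h1 h2|//]; first by rewrite normc0.
by apply: le_trans (le_normcD _ _) _; rewrite lerD.
Qed.

Lemma sum_fset_le (T : choiceType) (F F' : {fset T}) (f : T -> R) : (F `<=` F')%fset ->
  (forall g, 0 <= f g) -> \sum_(g <- F) f g <= \sum_(g <- F') f g.
Proof.
move=> /fsubsetP FF' f0.
have -> : \sum_(g <- F) f g = \sum_(g <- F' | g \in F) f g.
  rewrite -[RHS]big_filter; apply: perm_big; apply: uniq_perm => [//||g].
    by rewrite filter_uniq.
  by rewrite mem_filter andb_idr //; apply: FF'.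
by rewrite big_mkcond; apply: ler_sum => g _; case: ifP.
Qed.

End ComplexModulus.

Section GroupAlgebraCoefficients.
Variables (R : realType) (G : groupType).
Local Notation CG := (grpalg R[i] G).
Implicit Types (x y w : CG) (g h : G).

Lemma grpalgP x y : (forall g, mcoeff g x = mcoeff g y) -> x = y.
Proof. by move=> /malgP. Qed.

Lemma mcoeff_gterm (c : R[i]) g h : mcoeff h (gterm c g) = c *+ (g == h).
Proof. exact: mcoeffU. Qed.

Lemma mcoeff_sum (I : Type) (r : seq I) (P : pred I) (F : I -> CG) h :
  mcoeff h (\sum_(i <- r | P i) F i) = \sum_(i <- r | P i) mcoeff h (F i).
Proof. exact: raddf_sum. Qed.

Lemma mcoeff_gtermM (c : R[i]) g w h :
  mcoeff h (gterm c g * w) = c * mcoeff (g^-1 * h)%g w.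
Proof.
rewrite {1}(grpalgE w) [_ * _]grpalg_mul_sumr mcoeff_sum.
under eq_bigr => k _ do rewrite gtermM mcoeff_gterm.
have [gw|gw] := boolP ((g^-1 * h)%g \in msupp w).
  rewrite (big_fsetD1 _ gw) /= mulKVg eqxx mulr1n big_seq big1 ?addr0 //.
  move=> k; rewrite in_fsetD1 => /andP[kg _].
  by case: eqP => // e; rewrite -e mulKg eqxx in kg.
rewrite (mcoeff_outdom gw) mulr0 big_seq big1 // => k kw.
by case: eqP => // e; rewrite -e mulKg kw in gw.
Qed.

(** On finitely supported functions the left regular representation is left
    multiplication in the group algebra. *)
Lemma lambda_mcoeff x w h : lambda x (mcoeff^~ w) h = mcoeff h (x * w).
Proof.
rewrite [in RHS](grpalgE x) [_ * _ in RHS]grpalg_mul_suml mcoeff_sum.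
rewrite /lambda /linext fct_sumE; apply: eq_bigr => g _.
by rewrite mcoeff_gtermM.
Qed.

Lemma mcoeff_star x h : mcoeff h (grpalg_star x) = (mcoeff (h^-1)%g x)^*.
Proof.
rewrite /grpalg_star mcoeff_sum.
under eq_bigr => k _ do rewrite mcoeff_gterm eqg_invLR.
have [hx|hx] := boolP ((h^-1)%g \in msupp x).
  rewrite (big_fsetD1 _ hx) /= eqxx mulr1n big_seq big1 ?addr0 // => k.
  by rewrite in_fsetD1 => /andP[/negPf -> _].
rewrite (mcoeff_outdom hx) conjc0 big_seq big1 // => k kx.
by case: eqP => // e; rewrite -e kx in hx.
Qed.

Lemma starK x : grpalg_star (grpalg_star x) = x.
Proof. by apply: grpalgP => g; rewrite !mcoeff_star invgK conjcK. Qed.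

Lemma star_gterm (c : R[i]) g : grpalg_star (gterm c g) = gterm c^* (g^-1)%g.
Proof.
apply: grpalgP => h; rewrite mcoeff_star !mcoeff_gterm eqg_invLR.
by case: eqP => //; rewrite mulr0n conjc0.
Qed.

Lemma starD x y : grpalg_star (x + y) = grpalg_star x + grpalg_star y.
Proof.
by apply: grpalgP => g; rewrite mcoeffD !mcoeff_star mcoeffD rmorphD.
Qed.

Lemma star0 : grpalg_star (0 : CG) = 0.
Proof. by apply: grpalgP => g; rewrite mcoeff_star !mcoeff0 conjc0. Qed.

Lemma star_sum (I : Type) (r : seq I) (F : I -> CG) :
  grpalg_star (\sum_(i <- r) F i) = \sum_(i <- r) grpalg_star (F i).
Proof. exact: (big_morph _ starD star0). Qed.

Lemma starM x y : grpalg_star (x * y) = grpalg_star y * grpalg_star x.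
Proof.
rewrite {1}(grpalgE x) {1}(grpalgE y) mulr_suml star_sum.
rewrite [in RHS]/grpalg_star mulr_sumr; apply: eq_bigr => g _.
rewrite mulr_sumr star_sum mulr_suml; apply: eq_bigr => h _.
by rewrite [_ * _]gtermM star_gterm [RHS]gtermM rmorphM mulrC invgM.
Qed.

Lemma self_adjoint_starM x : self_adjoint (grpalg_star x * x).
Proof. by rewrite /self_adjoint starM starK. Qed.

End GroupAlgebraCoefficients.

Section SquareNorm.
Variables (R : realType) (G : groupType).
Local Notation CG := (grpalg R[i] G).
Implicit Types (x y w : CG) (g h : G).

(** The square of the l^2 norm. *)
Definition sqn w : R := \sum_(g <- msupp w) normc (mcoeff g w) ^+ 2.

Lemma sqn_ge0 w : 0 <= sqn w.
Proof. by apply: sumr_ge0 => g _; rewrite sqr_ge0. Qed.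

Lemma sqn_wide (F : {fset G}) w : (msupp w `<=` F)%fset ->
  sqn w = \sum_(g <- F) normc (mcoeff g w) ^+ 2.
Proof.
move=> wF; rewrite /sqn (big_fset_incl _ wF) //= => g _ /mcoeff_outdom ->.
by rewrite normc0 expr0n.
Qed.

Lemma sqn_ge_part (F : {fset G}) w :
  \sum_(g <- F) normc (mcoeff g w) ^+ 2 <= sqn w.
Proof.
rewrite (sqn_wide (fsubsetUr F (msupp w))).
by apply: sum_fset_le => [|g]; [exact: fsubsetUl | exact: sqr_ge0].
Qed.

Lemma normc_mcoeff_sqn g w : normc (mcoeff g w) ^+ 2 <= sqn w.
Proof. by have := sqn_ge_part [fset g]%fset w; rewrite big_seq_fset1. Qed.

Lemma sqnZ (c : R[i]) w : sqn (c *: w) = normc c ^+ 2 * sqn w.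
Proof.
have sZ : (msupp (c *: w) `<=` msupp w)%fset by exact: msuppZ_le.
rewrite (sqn_wide sZ) mulr_sumr; apply: eq_bigr => g _.
by rewrite mcoeffZ normcM exprMn.
Qed.

Lemma sqn1 : sqn 1 = 1.
Proof.
have s1 : (msupp (1 : CG) `<=` [fset 1%g])%fset by exact: msuppU_le.
by rewrite (sqn_wide s1) big_seq_fset1 mcoeff_gterm eqxx mulr1n normc1 expr1n.
Qed.

Lemma ell2norm_mcoeff w :
  ell2norm (mcoeff^~ w : G -> R[i]) = (Num.sqrt (sqn w))%:E.
Proof.
rewrite /ell2norm; set E := esum _ _.
suff -> : E = (sqn w)%:E by [].
rewrite /E /sqn -(set_fsetK (msupp w)) -sumEFin -fsbig_finite; last exact: finite_fset.
rewrite -esum_fset; last 2 first.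
- exact: finite_fset.
- by move=> g _; rewrite lee_fin sqr_ge0.
rewrite [RHS]esum_mkcond; apply: eq_esum => g _.
case: ifPn => // /negP gw; rewrite mcoeff_outdom ?normc0 ?expr0n //.
by apply/negP => h; apply: gw; rewrite inE.
Qed.

(** The operator norm is a supremum over the unit ball, so [w] is rescaled to
    it; [w = 0] cannot be and is treated apart. *)
Lemma lambda_norm_sqn x (c : R) w : 0 <= c ->
  (lambda_norm x <= c%:E)%E -> sqn (x * w) <= c ^+ 2 * sqn w.
Proof.
move=> c0 xc; have [s0|s0] := eqVneq (sqn w) 0.
  suff -> : w = 0 by rewrite mulr0 /sqn msupp0 !big_seq_fset0 mulr0.
  apply: grpalgP => g; rewrite mcoeff0; apply: eq0_normc.
  have := normc_mcoeff_sqn g w; rewrite s0 => h.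
  by apply/eqP; rewrite -sqrf_eq0 eq_le h sqr_ge0.
have s1 : 0 < sqn w by rewrite lt_neqAle eq_sym s0 sqn_ge0.
pose t := (Num.sqrt (sqn w))^-1.
have t2 : t ^+ 2 = (sqn w)^-1 by rewrite exprVn sqr_sqrtr // sqn_ge0.
pose v : CG := t%:C *: w.
have v1 : sqn v = 1 by rewrite sqnZ normc_real real_normK ?num_real // t2 mulVf.
have xv h : mcoeff h (x * v) = mcoeff h (t%:C *: (x * w)).
  transitivity (t%:C * mcoeff h (x * w)); last by symmetry; exact: mcoeffZ.
  apply: etrans (esym (lambda_mcoeff x v h)) _.
  rewrite -[mcoeff h (x * w)]lambda_mcoeff.
  rewrite /lambda /linext !fct_sumE mulr_sumr; apply: eq_bigr => g _.
  change (mcoeff g x * mcoeff (g^-1 * h)%g v =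
    t%:C * (mcoeff g x * mcoeff (g^-1 * h)%g w)).
  by rewrite /v mcoeffZ mulrCA.
have {}xv : x * v = t%:C *: (x * w) by apply: grpalgP.
have : (ell2norm (lambda x (mcoeff^~ v)) <= c%:E)%E.
  apply: le_trans xc; apply: ereal_sup_ubound; exists (mcoeff^~ v) => //=.
  by rewrite ell2norm_mcoeff v1 sqrtr1.
have -> : lambda x (mcoeff^~ v) = mcoeff^~ (x * v).
  by apply/funext => h; rewrite lambda_mcoeff.
rewrite ell2norm_mcoeff lee_fin xv sqnZ normc_real.
rewrite real_normK ?num_real // t2 -{1}(ger0_norm c0) -sqrtr_sqr.
by rewrite ler_sqrt ?sqr_ge0 // mulrC ler_pdivrMr.
Qed.

(** Operator bounds can be tested on finitely supported vectors: finitely many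
    values of [lambda y f] depend on finitely many values of [f], so [f] may
    be truncated to an element [w] of the group algebra. *)
Lemma sqn_lambda_norm y (c : R) : 0 <= c ->
  (forall w, sqn (y * w) <= c ^+ 2 * sqn w) -> (lambda_norm y <= c%:E)%E.
Proof.
move=> c0 yc; apply: ge_ereal_sup => _ [f /= f1 <-].
have e0 (f' : G -> R[i]) : (0 <= \esum_(g in [set: G]) (normc (f' g) ^+ 2)%:E)%E.
  by apply: esum_ge0 => g _; rewrite lee_fin sqr_ge0.
have f1' : (\esum_(g in [set: G]) (normc (f g) ^+ 2)%:E <= 1)%E.
  by rewrite -lee_sqrt // -[X in (_ <= X)%E]/((Num.sqrt 1)%:E) sqrtr1.
have -> : c%:E = sqrte (c ^+ 2)%:E by rewrite /= sqrtr_sqr ger0_norm.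
rewrite lee_sqrt ?lee_fin ?sqr_ge0 //.
apply: ge_ereal_sup => _ [X [finX _] <-].
rewrite fsbig_finite //; set F := fset_set X.
rewrite sumEFin lee_fin.
(* The points at which [f] enters the values of [lambda y f] on [F]. *)
pose F' := [fset (k^-1 * h)%g | k in msupp y, h in F]%fset.
pose w : CG := \sum_(g <- F') gterm (f g) g.
have wE g : mcoeff g w = if g \in F' then f g else 0.
  rewrite mcoeff_sum; under eq_bigr => k _ do rewrite mcoeff_gterm.
  case: ifPn => gF.
    rewrite (big_fsetD1 _ gF) /= eqxx mulr1n big_seq big1 ?addr0 // => k.
    by rewrite in_fsetD1 => /andP[/negPf -> _].
  rewrite big_seq big1 // => k kF; case: eqP => // e.
  by rewrite -e kF in gF.
have sw : sqn w <= 1.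
  rewrite (@sqn_wide F').
    rewrite -lee_fin; apply: le_trans f1'; apply: esum_ge.
    exists [set` F']; first by split=> //; exact: finite_fset.
    rewrite fsbig_finite ?set_fsetK; last exact: finite_fset.
    rewrite sumEFin lee_fin big_seq [leRHS]big_seq; apply: ler_sum => g gF.
    by rewrite wE gF.
  by apply/fsubsetP => g; rewrite -mcoeff_neq0 wE; case: ifP => //; rewrite eqxx.
apply: (@le_trans _ _ (sqn (y * w))).
  apply: le_trans (sqn_ge_part F _); rewrite big_seq [leRHS]big_seq.
  apply: ler_sum => h hF; rewrite -lambda_mcoeff.
  suff -> : lambda y f h = lambda y (mcoeff^~ w) h by [].
  rewrite /lambda /linext !fct_sumE big_seq [RHS]big_seq.
  apply: eq_bigr => g gy.
  change (mcoeff g y * f (g^-1 * h)%g = mcoeff g y * mcoeff (g^-1 * h)%g w).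
  suff ghF : (g^-1 * h)%g \in F' by rewrite wE ghF.
  by apply/imfset2P; exists g => //; exists h.
by apply: le_trans (yc w) _; rewrite ler_piMr // sqr_ge0.
Qed.

(** The inner product of [l^2], written with the product of the algebra so that
    the adjunction below is mere associativity. *)
Definition ip w y : R[i] := mcoeff 1%g (grpalg_star w * y).

Lemma ipE (F : {fset G}) w y : (msupp w `<=` F)%fset ->
  ip w y = \sum_(g <- F) (mcoeff g w)^* * mcoeff g y.
Proof.
move=> wF; rewrite -(big_fset_incl _ wF); last first.
  by move=> g _ /mcoeff_outdom ->; rewrite rmorph0 mul0r.
rewrite /ip {1}/grpalg_star mulr_suml mcoeff_sum; apply: eq_bigr => g _.
by rewrite mcoeff_gtermM invgK mulg1.
Qed.

Lemma ipww w : ip w w = (sqn w)%:C.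
Proof.
rewrite (ipE _ (fsubset_refl _)) rmorph_sum; apply: eq_bigr => g _.
by rewrite conjM_normc.
Qed.

Lemma normc_ip_le (t : R) w y : 0 < t ->
  2 * normc (ip w y) <= t * sqn w + t^-1 * sqn y.
Proof.
move=> t0; pose F := (msupp w `|` msupp y)%fset.
have wF : (msupp w `<=` F)%fset by exact: fsubsetUl.
have yF : (msupp y `<=` F)%fset by exact: fsubsetUr.
rewrite (ipE _ wF) (sqn_wide wF) (sqn_wide yF) !mulr_sumr -big_split /=.
apply: le_trans (ler_wpM2l _ (normc_sum _ _ _)) _ => //.
rewrite mulr_sumr; apply: ler_sum => g _.
rewrite normcM normc_conj.
move: (normc (mcoeff g w)) (normc (mcoeff g y)) => u v; rewrite -subr_ge0.
have -> : t * u ^+ 2 + t^-1 * v ^+ 2 - 2 * (u * v) = t * (u - v / t) ^+ 2.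
  by field; rewrite gt_eqF.
by rewrite mulr_ge0 ?sqr_ge0 // ltW.
Qed.

Lemma ip_adjoint x v w : ip v (grpalg_star x * w) = ip (x * v) w.
Proof.
have e : grpalg_star v * (grpalg_star x * w) = grpalg_star (x * v) * w.
  by rewrite starM mulrA.
exact: (congr1 (mcoeff 1%g) e).
Qed.

(** The adjoint of an operator has the same norm. Writing [v] for the image of
    [w] under the adjoint, [|v|^2 = <x v, w>] is at most
    [(c^-2 |x v|^2 + c^2 |w|^2) / 2 <= (|v|^2 + c^2 |w|^2) / 2]. *)
Lemma sqn_starM x (c : R) : 0 < c -> (forall w, sqn (x * w) <= c ^+ 2 * sqn w) ->
  forall w, sqn (grpalg_star x * w) <= c ^+ 2 * sqn w.
Proof.
move=> c0 xc w.
have [v vE] : exists v, v = grpalg_star x * w by eexists.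
rewrite -vE.
have e : ip v v = ip (x * v) w.
  by rewrite {2}vE; exact: ip_adjoint.
have c2 : 0 < c ^- 2 by rewrite invr_gt0 exprn_gt0.
have {e} e : normc (ip (x * v) w) = sqn v.
  by rewrite -e ipww normc_real ger0_norm ?sqn_ge0.
have := normc_ip_le (x * v) w c2; rewrite e invrK => h.
have h2 : c ^- 2 * sqn (x * v) <= sqn v.
  by rewrite mulrC ler_pdivrMr ?exprn_gt0 // mulrC.
lra.
Qed.

Lemma lambda_norm_starM x (c : R) : 0 < c -> (lambda_norm x <= c%:E)%E ->
  (lambda_norm (grpalg_star x * x)%R <= (c ^+ 2)%:E)%E.
Proof.
move=> c0 xc; apply: sqn_lambda_norm => [|w]; first exact: sqr_ge0.
have xc' w' := lambda_norm_sqn w' (ltW c0) xc.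
rewrite -mulrA; apply: le_trans (sqn_starM c0 xc' _) _.
by rewrite (expr2 (c ^+ 2)) -mulrA ler_wpM2l ?sqr_ge0.
Qed.

(** The canonical trace is bounded by the operator norm, as
    [|tau(y^n)| <= |lambda(y)^n delta_1|]; this is the temperedness of
    the leading term of the expansion. *)
Lemma normc_mcoeff1_exp y (c : R) n : 0 <= c -> (lambda_norm y <= c%:E)%E ->
  normc (mcoeff 1%g (y ^+ n)) <= c ^+ n.
Proof.
move=> c0 yc; have h : sqn (y ^+ n) <= (c ^+ n) ^+ 2.
  elim: n => [|n IH]; first by rewrite expr0 sqn1 expr0 expr1n.
  rewrite exprS; apply: le_trans (lambda_norm_sqn _ c0 yc) _.
  by rewrite [c ^+ n.+1]exprS exprMn ler_wpM2l ?sqr_ge0.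
rewrite -(@ler_pXn2r _ 2) ?nnegrE ?normc_ge0 ?exprn_ge0 //.
exact: le_trans (normc_mcoeff_sqn _ _) h.
Qed.

End SquareNorm.

(** * Word length, linear extension and temperedness *)

Section WordLengthTheory.
Variables (G : groupType) (S : {fset G}) (genS : generates S).
Local Notation len := (word_length genS).

Lemma word_length1 : len 1%g = 0%N.
Proof.
rewrite /word_length; case: ex_minnP => n _ /(_ 0%N) h.
apply/eqP; rewrite -leqn0; apply: h; apply/asboolP; exists [tuple]; split=> //.
by rewrite big_nil.
Qed.

Lemma word_lengthM g h : (len (g * h)%g <= len g + len h)%N.
Proof.
rewrite {1}/word_length; case: ex_minnP => n _; apply.
rewrite /word_length; case: ex_minnP => p /asboolP[v [vS <-]] _.
case: ex_minnP => q /asboolP[w [wS <-]] _.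
apply/asboolP; exists (cat_tuple v w); split; last by rewrite big_cat.
by move=> s; rewrite mem_cat => /orP[/vS|/wS].
Qed.

End WordLengthTheory.

Section LinearExtension.
Variables (R : realType) (G : groupType).
Local Notation CG := (grpalg R[i] G).
Implicit Types (x y w : CG) (g h : G).

Lemma linext_wide (V : lmodType R[i]) (f : G -> V) (F : {fset G}) w :
  (msupp w `<=` F)%fset -> linext f w = \sum_(g <- F) mcoeff g w *: f g.
Proof.
move=> wF; rewrite /linext (big_fset_incl _ wF) //= => g _ /mcoeff_outdom ->.
by rewrite scale0r.
Qed.

Lemma linextD (V : lmodType R[i]) (f : G -> V) w y :
  linext f (w + y) = linext f w + linext f y.
Proof.
rewrite (linext_wide f (msuppD_le w y)) (linext_wide f (fsubsetUl (msupp w) (msupp y))).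
rewrite (linext_wide f (fsubsetUr (msupp w) (msupp y))) -big_split /=.
by apply: eq_bigr => g _; rewrite mcoeffD scalerDl.
Qed.

Lemma linext0 (V : lmodType R[i]) (f : G -> V) : linext f 0 = 0.
Proof. by rewrite /linext msupp0 big_seq_fset0. Qed.

Lemma linext_sum (V : lmodType R[i]) (f : G -> V) (I : Type) (r : seq I)
    (E : I -> CG) :
  linext f (\sum_(i <- r) E i) = \sum_(i <- r) linext f (E i).
Proof. exact: (big_morph _ (linextD f) (linext0 f)). Qed.

Lemma linext_gterm (V : lmodType R[i]) (f : G -> V) c g :
  linext f (gterm c g) = c *: f g.
Proof.
by rewrite (linext_wide f (@msuppU_le _ _ g c)) big_seq_fset1 mcoeff_gterm
  eqxx mulr1n.
Qed.

Lemma msuppM_ex x y h : h \in msupp (x * y) ->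
  exists g k, [/\ g \in msupp x, k \in msupp y & h = (g * k)%g].
Proof.
rewrite -mcoeff_neq0 -lambda_mcoeff /lambda /linext fct_sumE => nz.
apply: contrapT => none; move/eqP: nz; apply.
rewrite big_seq big1 // => g gx.
rewrite -[LHS]/(mcoeff g x * mcoeff (g^-1 * h)%g y).
have [ghy|ghy] := boolP ((g^-1 * h)%g \in msupp y); last first.
  by rewrite (mcoeff_outdom ghy) mulr0.
by case: none; exists g, (g^-1 * h)%g; rewrite mulKVg.
Qed.

Definition l1 w : R := \sum_(g <- msupp w) normc (mcoeff g w).

Lemma l1_ge0 w : 0 <= l1 w.
Proof. by apply: sumr_ge0 => g _; exact: normc_ge0. Qed.

Lemma l1_wide (F : {fset G}) w : (msupp w `<=` F)%fset ->
  l1 w = \sum_(g <- F) normc (mcoeff g w).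
Proof.
move=> wF; rewrite /l1 (big_fset_incl _ wF) //= => g _ /mcoeff_outdom ->.
by rewrite normc0.
Qed.

Lemma l1D w y : l1 (w + y) <= l1 w + l1 y.
Proof.
rewrite (l1_wide (msuppD_le w y)) (l1_wide (fsubsetUl (msupp w) (msupp y))).
rewrite (l1_wide (fsubsetUr (msupp w) (msupp y))) -big_split /=.
by apply: ler_sum => g _; rewrite mcoeffD le_normcD.
Qed.

Lemma l1_sum (I : Type) (r : seq I) (E : I -> CG) :
  l1 (\sum_(i <- r) E i) <= \sum_(i <- r) l1 (E i).
Proof.
elim: r => [|i r IH]; first by rewrite !big_nil /l1 msupp0 big_seq_fset0.
by rewrite !big_cons; apply: le_trans (l1D _ _) _; rewrite lerD2l.
Qed.

Lemma l1_gterm c g : l1 (gterm c g) = normc c.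
Proof.
by rewrite (l1_wide (@msuppU_le _ _ g c)) big_seq_fset1 mcoeff_gterm
  eqxx mulr1n.
Qed.

Lemma l1M x y : l1 (x * y) <= l1 x * l1 y.
Proof.
rewrite {1}(grpalgE x) {1}(grpalgE y) mulr_suml.
apply: le_trans (l1_sum _ _) _; rewrite [l1 x]/l1 mulr_suml.
apply: ler_sum => g _; rewrite mulr_sumr; apply: le_trans (l1_sum _ _) _.
rewrite mulr_sumr; apply: ler_sum => h _.
by rewrite [_ * _]gtermM l1_gterm normcM.
Qed.

Lemma l1X x n : l1 (x ^+ n) <= l1 x ^+ n.
Proof.
elim: n => [|n IH]; first by rewrite !expr0 l1_gterm normc1.
by rewrite !exprS; apply: le_trans (l1M _ _) _; rewrite ler_wpM2l ?l1_ge0.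
Qed.

Lemma normc_linext_le (T : G -> R[i]) (E : R) w :
  (forall g, g \in msupp w -> normc (T g) <= E) ->
  normc (linext (V := R[i]) T w) <= l1 w * E.
Proof.
move=> TE; apply: le_trans (normc_sum _ _ _) _; rewrite /l1 mulr_suml.
rewrite big_seq [leRHS]big_seq; apply: ler_sum => g gw.
by rewrite normcM ler_wpM2l ?normc_ge0 // TE.
Qed.

Lemma word_length_msuppX (S : {fset G}) (genS : generates S) y K :
  (forall g, g \in msupp y -> (word_length genS g <= K)%N) ->
  forall j g, g \in msupp (y ^+ j) -> (word_length genS g <= j * K)%N.
Proof.
move=> yK; elim=> [|j IH] g.
  rewrite expr0 => /(fsubsetP (@msuppU_le _ _ 1%g (1 : R[i]))).
  by rewrite inE => /eqP ->; rewrite word_length1.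
rewrite exprS => /msuppM_ex [h [k [hy ky ->]]].
apply: leq_trans (word_lengthM _ _ _) _.
by rewrite mulSn leq_add ?yK ?IH.
Qed.

(** Real parts suffice in what follows because the random moments are real. *)
Lemma Re_expansion (T : G -> R[i]) (u : nat -> G -> R) w s (t E : R) :
  (forall g, g \in msupp w ->
    normc (T g - (\sum_(k < s) u k g * t ^+ k)%:C) <= E) ->
  `|complex.Re (linext (V := R[i]) T w) -
    \sum_(k < s) complex.Re (linext (V := R[i]) (fun g => (u k g)%:C) w)
      * t ^+ k| <= l1 w * E.
Proof.
move=> TE; apply: le_trans (normc_linext_le TE).
apply: le_trans (Re_le_normc _); rewrite le_eqVlt; apply/orP; left; apply/eqP.
congr (`| _ |).
have ReD (a b : R[i]) : complex.Re (a + b) = complex.Re a + complex.Re b.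
  by case: a; case: b.
have ReS (I : Type) (r : seq I) (F : I -> R[i]) :
    complex.Re (\sum_(i <- r) F i) = \sum_(i <- r) complex.Re (F i).
  by apply: (big_morph _ ReD).
have ReM (a : R[i]) (b : R) : complex.Re (a * b%:C) = complex.Re a * b.
  by case: a => p q /=; rewrite mulr0 subr0.
rewrite /linext !ReS.
under [X in _ - X]eq_bigr => k _ do rewrite ReS mulr_suml.
rewrite exchange_big -sumrB; apply: eq_bigr => g _ /=.
rewrite -[RHS]/(complex.Re (mcoeff g w * _)) mulrBr.
rewrite -[complex.Re (_ - _)]/(complex.Re (_ + (- _))) ReD -mulrN -rmorphN ReM.
rewrite mulrN mulr_sumr; congr (_ - _); apply: eq_bigr => k _.
by rewrite -[_ *: _]/(_ * _) ReM mulrA.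
Qed.

(** The limsup controls all but finitely many powers; the constant [B] takes
    care of the others. *)
Lemma tempered_bound (f : CG -> R[i]) y (r0 r1 : R) : 0 < r1 -> r0 < r1 ->
  tempered f y -> (lambda_norm y <= r0%:E)%E ->
  exists2 B : R, 0 <= B & forall j, normc (f (y ^+ j)) <= B * r1 ^+ j.
Proof.
move=> r1_0 r01 temp yr.
have : (limn_esup (fun p => (normc (f (y ^+ p)) `^ p%:R^-1)%:E) < r1%:E)%E.
  by apply: le_lt_trans temp _; apply: le_lt_trans yr _; rewrite lte_fin.
move=> /ereal_inf_lt [_ [V [n _ nV] <-] sup_lt].
have big p : (n <= p)%N -> (0 < p)%N -> normc (f (y ^+ p)) <= r1 ^+ p.
  move=> np p0.
  have : ((normc (f (y ^+ p)) `^ p%:R^-1)%:E < r1%:E)%E.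
    apply: le_lt_trans sup_lt; apply: ereal_sup_ubound.
    by exists p => //; apply: nV.
  rewrite lte_fin => /ltW h.
  have := @lerXn2r _ p _ _ (powR_ge0 _ _) (ltW r1_0) h.
  rewrite -(powR_mulrn _ (powR_ge0 _ _)) -powRrM mulVf ?pnatr_eq0 -?lt0n // powRr1 //.
  exact: normc_ge0.
pose b j := normc (f (y ^+ j)) / r1 ^+ j.
have b0 j : 0 <= b j by rewrite divr_ge0 ?normc_ge0 // exprn_ge0 // ltW.
exists (1 + \sum_(j < n.+1) b j) => [|j]; first by rewrite addr_ge0 // sumr_ge0.
case: (ltnP j n.+1) => jn.
  rewrite -ler_pdivrMr ?exprn_gt0 // -/(b j) (bigD1 (Ordinal jn)) //=.
  rewrite addrCA lerDl addr_ge0 //; exact: sumr_ge0.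
apply: le_trans (big j (ltnW jn) (leq_ltn_trans (leq0n n) jn)) _.
rewrite ler_peMl ?exprn_ge0 ?(ltW r1_0) // lerDl; exact: sumr_ge0.
Qed.

End LinearExtension.

(** * Spectra of Gram matrices *)

Section GramSpectrum.
Variable C : numClosedFieldType.

Definition adj m n (A : 'M[C]_(m, n)) : 'M[C]_(n, m) := map_mx Num.conj A^T.

Lemma adjK m n (A : 'M[C]_(m, n)) : adj (adj A) = A.
Proof. by apply/matrixP => i j; rewrite !mxE conjCK. Qed.

Lemma adjM m n p (A : 'M[C]_(m, n)) (B : 'M[C]_(n, p)) :
  adj (A *m B) = adj B *m adj A.
Proof. by rewrite /adj trmx_mul map_mxM. Qed.

Definition sqnorm n (w : 'cV[C]_n) : C := \sum_i `|w i 0| ^+ 2.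

Lemma sqnormE n (w : 'cV[C]_n) : sqnorm w = (adj w *m w) 0 0.
Proof.
by rewrite mxE; apply: eq_bigr => i _; rewrite !mxE normCK mulrC.
Qed.

Lemma sqnorm_unitary n (P : 'M[C]_n) (w : 'cV[C]_n) :
  P \is unitarymx -> sqnorm (P *m w) = sqnorm w.
Proof.
move=> Pu; rewrite !sqnormE adjM -mulmxA (mulmxA (adj P)).
suff -> : adj P *m P = 1%:M by rewrite mul1mx.
by rewrite /adj -invmx_unitary // mulVmx // unitarymx_unit.
Qed.

(** The spectral theorem for the normal matrix [adj T *m T]; an eigenvalue is
    the squared norm of the image under [T] of a unit eigenvector, hence
    nonnegative. *)
Lemma gram_spectral n (T : 'M[C]_n) : exists (P : 'M[C]_n) (d : 'rV[C]_n),
  [/\ P \is unitarymx, forall i, 0 <= d 0 i &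
      adj T *m T = adj P *m diag_mx d *m P].
Proof.
have Hn : adj T *m T \is normalmx.
  by apply/normalmxP; rewrite -/(adj (adj T *m T)) adjM adjK.
set H := adj T *m T in Hn *; pose P := spectralmx H; pose d := spectral_diag H.
have Pu : P \is unitarymx by exact: spectral_unitarymx.
have HE : H = adj P *m diag_mx d *m P.
  by rewrite /adj -invmx_unitary //; exact/orthomx_spectralP.
exists P, d; split=> // i.
have PP : P *m adj P = 1%:M by apply/unitarymxP.
have : P *m H *m adj P = diag_mx d.
  by rewrite HE !mulmxA PP mul1mx -mulmxA PP mulmx1.
have -> : P *m H *m adj P = adj (T *m adj P) *m (T *m adj P).
  by rewrite adjM adjK /H !mulmxA.
move=> /matrixP/(_ i i); rewrite [in RHS]mxE eqxx mulr1n => <-.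
rewrite mxE sumr_ge0 // => k _.
by rewrite [adj _ i k]mxE [_^T i k]mxE mulrC -normCK exprn_ge0.
Qed.

Lemma trace_conj_diag_exp n (P : 'M[C]_n) (d : 'rV[C]_n) k :
  P \is unitarymx -> \tr ((adj P *m diag_mx d *m P) ^+ k) = \sum_i d 0 i ^+ k.
Proof.
move=> Pu; have PP : P *m adj P = 1%:M by apply/unitarymxP.
have PP' : adj P *m P = 1%:M by apply: mulmx1C.
have -> : (adj P *m diag_mx d *m P) ^+ k =
    adj P *m diag_mx (\row_i d 0 i ^+ k) *m P.
  elim: k => [|k IH].
    rewrite expr0 (_ : diag_mx _ = 1%:M) ?mulmx1 ?PP' //.
    by apply/matrixP => i j; rewrite !mxE expr0.
  rewrite exprS IH -[LHS]/(_ *m _) !mulmxA; congr (_ *m _).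
  rewrite -(mulmxA _ P) PP mulmx1 -mulmxA; congr (_ *m _).
  by rewrite mulmx_diag; congr diag_mx; apply/rowP => i; rewrite !mxE exprS.
rewrite mxtrace_mulC mulmxA PP mul1mx mxtrace_diag.
by apply: eq_bigr => i _; rewrite mxE.
Qed.

Lemma sqnorm_gram_le n (T P : 'M[C]_n) (d : 'rV[C]_n) (r : C) (w : 'cV[C]_n) :
  P \is unitarymx -> adj T *m T = adj P *m diag_mx d *m P ->
  (forall i, d 0 i <= r) -> sqnorm (T *m w) <= r * sqnorm w.
Proof.
move=> Pu TE dr; rewrite -(sqnorm_unitary w Pu) sqnormE adjM -mulmxA.
rewrite (mulmxA (adj T)) TE -2!mulmxA mulmxA -adjM.
set v := P *m w; rewrite mul_diag_mx /sqnorm mulr_sumr mxE; apply: ler_sum => i _.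
by rewrite !mxE mulrCA [_^* * _]mulrC -normCK ler_wpM2r ?exprn_ge0.
Qed.

End GramSpectrum.

(** * The standard representation as matrices *)

Section StandardTrace.
Variables (R : realType) (N : nat).
Hypothesis N_gt0 : (0 < N)%N.
Local Notation C := R[i].

Definition avgmx : 'M[C]_N := const_mx N%:R^-1.
(** The orthogonal projection onto the complement of the all-one vector. *)
Definition centermx : 'M[C]_N := 1%:M - avgmx.

Lemma avgmx_idem : avgmx *m avgmx = avgmx.
Proof.
apply/matrixP => i j; rewrite !mxE; under eq_bigr do rewrite !mxE.
rewrite sumr_const card_ord -[LHS]mulr_natl mulrA divff ?mul1r //.
by rewrite pnatr_eq0 -lt0n.
Qed.

Lemma center_idem : centermx *m centermx = centermx.
Proof.
rewrite {1}/centermx mulmxBl mul1mx /centermx mulmxBr mulmx1 avgmx_idem.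
by rewrite subrr subr0.
Qed.

Lemma center_adj : adj centermx = centermx.
Proof.
apply/matrixP => i j; rewrite !mxE rmorphB eq_sym; congr (_ - _).
  by rewrite rmorphMn rmorph1.
by rewrite fmorphV rmorph_nat.
Qed.

Lemma center_perm (s : 'S_N) : perm_mx s *m centermx = centermx *m perm_mx s.
Proof.
rewrite /centermx mulmxBr mulmxBl mul1mx mulmx1; congr (_ - _).
have -> : perm_mx s *m avgmx = avgmx.
  by apply/matrixP => i j; rewrite -row_permE !mxE.
by apply/matrixP => i j; rewrite -[s]invgK -col_permE !mxE.
Qed.

Lemma avgmx_one_perp (w : 'cV[C]_N) : w \in one_perp R N -> avgmx *m w = 0.
Proof.
rewrite mem_one_perp => /eqP w0; apply/matrixP => i j; rewrite !mxE ord1.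
under eq_bigr do rewrite mxE.
by rewrite -mulr_sumr w0 mulr0.
Qed.

Lemma center_id (w : 'cV[C]_N) : w \in one_perp R N -> centermx *m w = w.
Proof. by move=> /avgmx_one_perp e; rewrite mulmxBl mul1mx e subr0. Qed.

Lemma center_one_perp (w : 'cV[C]_N) : centermx *m w \in one_perp R N.
Proof.
rewrite mem_one_perp; apply/eqP.
have -> : \sum_i (centermx *m w) i 0 = \sum_j (\sum_i centermx i j) * w j 0.
  under eq_bigr => i _ do rewrite mxE.
  by rewrite exchange_big; apply: eq_bigr => j _; rewrite mulr_suml.
rewrite big1 // => j _; apply/eqP; rewrite mulf_eq0; apply/orP; left; apply/eqP.
under eq_bigr => i _ do rewrite !mxE.
have NV : N%:R^-1 *+ N = 1 :> C.
  by rewrite -[LHS]mulr_natl divff // pnatr_eq0 -lt0n.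
rewrite sumrB sumr_const card_ord NV.
rewrite (bigD1 j) //= eqxx mulr1n big1 ?addr0 ?subrr // => i ij.
by rewrite (negPf ij).
Qed.

(** Let [B] be the matrix of the inclusion of the standard space in coordinates
    and [L] that of the projection onto it; then [B *m L] is the projection,
    and the trace is that of [L *m M *m B], so the claim is the cyclicity of
    the trace. The basis need not be orthonormal. *)
Lemma std_traceE (a : 'End(std_space R N)) (M : 'M[C]_N) :
  (forall v, vsval (a v) = M *m vsval v) -> std_trace a = \tr (M *m centermx).
Proof.
move=> aM; rewrite /std_trace; set e := vbasis _.
have eb : basis_of {:std_space R N} e by exact: vbasisP.
set n := \dim _ in e eb *.
pose B : 'M[C]_(N, n) := \matrix_(i, j) (vsval e`_j) i 0.
pose cd i (w : 'cV[C]_N) : C := coord e i (vsproj (one_perp R N) (centermx *m w)).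
pose L : 'M[C]_(n, N) := \matrix_(i, k) cd i (delta_mx k 0).
have cdE (A : 'cV[C]_N) i : (L *m A) i 0 = cd i A.
  have -> : A = \sum_k A k 0 *: delta_mx k 0.
    by rewrite {1}[A]matrix_sum_delta; apply: eq_bigr => k _; rewrite big_ord1.
  rewrite /cd mulmx_sumr !linear_sum summxE; apply: eq_bigr => k _.
  by rewrite -scalemxAr -colE !linearZ /= !mxE.
have BL : B *m L = centermx.
  apply/matrixP => i k; rewrite mxE.
  have := coord_basis eb (memvf (vsproj (one_perp R N) (centermx *m delta_mx k 0))).
  move=> /(congr1 (fun v : std_space R N => (vsval v : 'cV[C]_N) i 0)).
  rewrite vsprojK ?center_one_perp // -colE mxE => ->.
  rewrite linear_sum summxE; apply: eq_bigr => j _.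
  by rewrite linearZ !mxE /cd -colE mulrC.
have -> : \tr (passmx.mxof e e a) = \sum_i coord e i (a e`_i).
  apply: eq_bigr => i _; rewrite mxE /= passmx.vecof_delta.
  by rewrite mxE.
rewrite -BL mulmxA [RHS]mxtrace_mulC; apply: eq_bigr => i _.
have -> : (L *m (M *m B)) i i = (L *m col i (M *m B)) i 0.
  by rewrite [in RHS]colE [in RHS]mulmxA -[in RHS]colE [RHS]mxE.
rewrite cdE /cd; congr (coord e i _); apply: subvs_inj.
rewrite vsprojK ?center_one_perp //.
have -> : col i (M *m B) = vsval (a e`_i).
  rewrite aM colE -mulmxA -colE; congr (_ *m _).
  by apply/matrixP => k l; rewrite !mxE ord1.
by rewrite center_id // subvsP.
Qed.

End StandardTrace.

Section PermutationModel.
Variables (R : realType) (G : groupType) (N : nat) (phi : G -> 'S_N).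
Hypothesis N_gt0 : (0 < N)%N.
Hypothesis phiM : homs G N phi.
Local Notation C := R[i].
Local Notation CG := (grpalg R[i] G).
Local Notation Q := (centermx R N).
Implicit Types (x y w : CG).

Definition perm_alg w : 'M[C]_N := linext (fun g => perm_mx (phi g)) w.

Lemma pi_algE w v : vsval (pi_alg phi w v) = perm_alg w *m vsval v.
Proof.
rewrite /pi_alg /perm_alg /linext sum_lfunE linear_sum mulmx_suml.
apply: eq_bigr => g _.
by rewrite scale_lfunE linearZ /= stdE scalemxAl.
Qed.

Lemma perm_algM x y : perm_alg (x * y) = perm_alg x *m perm_alg y.
Proof.
rewrite {1}(grpalgE x) {1}(grpalgE y) mulr_suml /perm_alg linext_sum mulmx_suml.
apply: eq_bigr => g _; rewrite mulr_sumr linext_sum mulmx_sumr.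
apply: eq_bigr => h _; rewrite [_ * _]gtermM linext_gterm phiM perm_mxM.
by rewrite -scalemxAl -scalemxAr scalerA.
Qed.

Lemma hom1 : phi 1%g = 1%g.
Proof. by apply: (mulgI (phi 1%g)); rewrite -phiM !mulg1. Qed.

Lemma homV g : phi (g^-1)%g = ((phi g)^-1)%g.
Proof. by apply: (mulgI (phi g)); rewrite -phiM !mulgV hom1. Qed.

Lemma perm_alg_star x : perm_alg (grpalg_star x) = adj (perm_alg x).
Proof.
rewrite {1}/grpalg_star /perm_alg linext_sum {2}/linext /adj linear_sum.
rewrite raddf_sum; apply: eq_bigr => g _.
rewrite linext_gterm homV linearZ /= map_mxZ tr_perm_mx map_perm_mx.
by [].
Qed.

Lemma perm_algQ w : perm_alg w *m Q = Q *m perm_alg w.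
Proof.
rewrite /perm_alg /linext mulmx_suml mulmx_sumr; apply: eq_bigr => g _.
by rewrite -scalemxAl center_perm scalemxAr.
Qed.

(** The exponent must be positive: the zeroth power on the left is the
    identity of the whole space. *)
Lemma perm_algXQ y j : (0 < j)%N ->
  (perm_alg y *m Q) ^+ j = perm_alg (y ^+ j) *m Q.
Proof.
case: j => // j _; elim: j => [|j IH]; first by rewrite !expr1.
rewrite exprS IH -[LHS]/(_ *m _) (exprS y j.+1) perm_algM.
rewrite -mulmxA (mulmxA Q) -perm_algQ -(mulmxA _ Q) center_idem //.
by rewrite !mulmxA.
Qed.

Lemma ntrace_pi_alg w : ntrace (pi_alg phi w) = \tr (perm_alg w *m Q) / N%:R.
Proof. by rewrite /ntrace (std_traceE N_gt0 (pi_algE w)). Qed.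

Lemma normc_trace_le w : normc (\tr (perm_alg w *m Q)) <= N%:R * l1 w.
Proof.
have -> : \tr (perm_alg w *m Q) =
    linext (V := C) (fun g => \tr (perm_mx (phi g) *m Q)) w.
  rewrite /perm_alg /linext mulmx_suml raddf_sum; apply: eq_bigr => g _.
  by rewrite -scalemxAl /= mxtraceZ.
rewrite mulrC; apply: normc_linext_le => g _.
apply: le_trans (normc_sum _ _ _) _.
have -> : N%:R = \sum_(i < N) (1 : R) by rewrite sumr_const card_ord.
apply: ler_sum => i _; rewrite -row_permE !mxE.
have N1 : 0 < N%:R^-1 :> R by rewrite invr_gt0 ltr0n.
have N2 : N%:R^-1 <= 1 :> R by rewrite invf_le1 ?ler1n ?ltr0n.
have -> : (phi g i == i)%:R - N%:R^-1 = ((phi g i == i)%:R - N%:R^-1)%:C :> C.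
  by rewrite rmorphB fmorphV !rmorph_nat.
rewrite normc_real ler_norml; case: (_ == _) => /=; lra.
Qed.

(** The [d i] are the eigenvalues of [adj T *m T], where [T] is the image of [x]
    compressed to the standard space and extended by zero; the extension adds
    an eigenvalue [0], invisible to positive moments. They are at most [l1 y]
    because [d i ^+ n] is at most the [n]-th moment, itself at most
    [N * l1 y ^+ n], for every [n]. *)
Lemma spectral_moments x (y := grpalg_star x * x) : exists d : 'I_N -> R,
  [/\ forall i, 0 <= d i <= l1 y,
      forall j, (0 < j)%N ->
        ntrace (pi_alg phi (y ^+ j)) = ((\sum_i d i ^+ j) / N%:R)%:C &
      forall r, 0 <= r -> (forall i, d i <= r ^+ 2) ->
        (std_norm (pi_alg phi x) <= r%:E)%E].
Proof.
pose T := perm_alg x *m Q.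
have [P [d' [Pu d'0 TE]]] := gram_spectral T.
pose d i := complex.Re (d' 0 i).
have dE i : d' 0 i = (d i)%:C by rewrite RRe_real // ger0_real.
have d0 i : 0 <= d i by have := d'0 i; rewrite dE lecR.
have HE : perm_alg y *m Q = adj T *m T.
  rewrite /T adjM center_adj -perm_alg_star mulmxA -(mulmxA Q) -perm_algM.
  by rewrite -perm_algQ -mulmxA center_idem.
have trE j : (0 < j)%N -> \tr (perm_alg (y ^+ j) *m Q) = (\sum_i d i ^+ j)%:C.
  move=> j0; rewrite -perm_algXQ // HE TE trace_conj_diag_exp // rmorph_sum.
  by apply: eq_bigr => i _; rewrite dE rmorphXn.
exists d; split.
- move=> i; rewrite d0 /= leNgt; apply/negP => ld.
  have l0 : 0 <= l1 y := l1_ge0 y.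
  have di : 0 < d i by apply: le_lt_trans ld.
  have q1 : 0 <= l1 y / d i < 1 by rewrite divr_ge0 //= ltr_pdivrMr // mul1r.
  have N0 : 0 < N%:R :> R by rewrite ltr0n.
  have [|n n0 qn] := @exists_pow_lt R _ (2 * N%:R)^-1 q1.
    by rewrite invr_gt0 mulr_gt0.
  have dn : 0 < d i ^+ n by rewrite exprn_gt0.
  have h1 : d i ^+ n <= N%:R * l1 y ^+ n.
    apply: (@le_trans _ _ (\sum_k d k ^+ n)).
      by rewrite (bigD1 i) //= lerDl sumr_ge0 // => k _; rewrite exprn_ge0.
    apply: le_trans (ler_norm _) _; rewrite -normc_real -trE //.
    apply: le_trans (normc_trace_le _) _.
    by rewrite ler_wpM2l ?l1X // ltW.
  move: qn; rewrite expr_div_n ler_pdivrMr // mulrC.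
  rewrite ler_pdivlMr ?mulr_gt0 //; lra.
- move=> j j0; rewrite ntrace_pi_alg trE // [in RHS]rmorphM fmorphV.
  by rewrite rmorph_nat.
- move=> r r0 dr; apply: ge_ereal_sup => _ [v /= v1 <-].
  have sqE (w : 'cV[C]_N) : sqnorm w = (\sum_i normc (w i 0) ^+ 2)%:C.
    by rewrite rmorph_sum; apply: eq_bigr => i _; rewrite rmorphXn.
  have av : vsval (pi_alg phi x v) = T *m vsval v.
    by rewrite pi_algE /T -mulmxA center_id // subvsP.
  have dr' i : d' 0 i <= (r ^+ 2)%:C by rewrite dE lecR.
  have := sqnorm_gram_le (vsval v) Pu TE dr'.
  rewrite -av !sqE -rmorphM lecR => h.
  move: v1; rewrite /std_vnorm !lee_fin => v1.
  have v1' : \sum_i normc ((vsval v : 'cV[C]_N) i 0) ^+ 2 <= 1.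
    rewrite -(@ler_sqrt _ _ 1) // sqrtr1 //.
  rewrite -(ger0_norm r0) -sqrtr_sqr; apply: ler_wsqrtr.
  by apply: le_trans h _; rewrite ler_piMr ?sqr_ge0.
Qed.

End PermutationModel.

(** * Uniform averages over homomorphisms *)

Section UniformLaw.
Variables (R : realType) (T : choiceType) (A : set T).
Hypotheses (finA : finite_set A) (A0 : A !=set0).
Local Notation card := (#|` fset_set A|)%:R.

Lemma card_fset_set_gt0 : 0 < card :> R.
Proof.
rewrite ltr0n cardfs_gt0; have [a Aa] := A0.
by apply/fset0Pn; exists a; rewrite in_fset_set // inE.
Qed.

Lemma unifP_ge0 B : 0 <= unifP R A B.
Proof. by rewrite divr_ge0. Qed.

Lemma unifPC B : unifP R A B = 1 - unifP R A (~` B).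
Proof.
rewrite /unifP; have c0 := card_fset_set_gt0.
have e : (#|` fset_set (A `&` B)| + #|` fset_set (A `&` ~` B)| =
    #|` fset_set A|)%N.
  rewrite -cardfsUI -fset_setU; try exact: finite_setIl.
  rewrite -setIUr setUv setIT -fset_setI; try exact: finite_setIl.
  by rewrite setIACA setICr setI0 fset_set0 cardfs0 addn0.
rewrite -[X in X - _](divff (lt0r_neq0 c0)) -mulrBl; congr (_ / _).
by rewrite -[in RHS]e natrD addrK.
Qed.

Lemma unifE_real (X : T -> R) (f : T -> R[i]) :
  (forall a, A a -> f a = (X a)%:C) ->
  unifE A f = ((\sum_(a <- fset_set A) X a) / card)%:C.
Proof.
move=> fX; rewrite /unifE rmorphM fmorphV rmorph_nat rmorph_sum; congr (_ / _).
rewrite big_seq [RHS]big_seq; apply: eq_bigr => a.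
by rewrite in_fset_set // inE => /fX.
Qed.

(** Markov's inequality for the uniform law. *)
Lemma unifP_markov (X : T -> R) (B : set T) (k : R) :
  (forall a, A a -> 0 <= X a) -> (forall a, A a -> B a -> k <= X a) ->
  unifP R A B * k <= (\sum_(a <- fset_set A) X a) / card.
Proof.
move=> X0 Xk; rewrite /unifP mulrAC ler_wpM2r // ?invr_ge0 //.
have sub : (fset_set (A `&` B) `<=` fset_set A)%fset.
  by rewrite -fset_set_sub //; exact: finite_setIl.
apply: (@le_trans _ _ (\sum_(a <- fset_set (A `&` B)) X a)); last first.
  rewrite big_seq [leRHS]big_seq.
  have X0' a : 0 <= (if a \in fset_set A then X a else 0).
    by case: ifPn => //; rewrite in_fset_set // inE => /X0.
  have := sum_fset_le sub X0'; rewrite big_seq [X in _ <= X -> _]big_seq.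
  congr (_ <= _); apply: eq_bigr => a aAB; last by rewrite aAB.
  by rewrite (fsubsetP sub).
have -> : (#|` fset_set (A `&` B)|)%:R * k = \sum_(a <- fset_set (A `&` B)) k.
  by rewrite big_const_seq count_predT iter_addr_0 mulr_natl.
rewrite big_seq [leRHS]big_seq; apply: ler_sum => a.
rewrite in_fset_set ?inE; last exact: finite_setIl.
by case=> Aa Ba; exact: Xk.
Qed.

End UniformLaw.

Section RandomModel.
(* Makes the linear structure of [mxof] available. *)
Import passmx.
Variables (R : realType) (G : groupType).
Local Notation C := R[i].
Local Notation CG := (grpalg R[i] G).

Lemma ntrace_linext N (phi : G -> 'S_N) (w : CG) :
  ntrace (pi_alg phi w) = linext (V := C) (fun g => ntrace (pi_rep R phi g)) w.
Proof.
rewrite /pi_alg /linext /ntrace /std_trace linear_sum raddf_sum mulr_suml.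
by apply: eq_bigr => g _; rewrite linearZ /= mxtraceZ -mulrA.
Qed.

Lemma linext_unifE (T : choiceType) (A : set T) (F : T -> G -> C) (w : CG) :
  linext (V := C) (fun g => unifE A (F^~ g)) w =
  unifE A (fun a => linext (V := C) (F a) w).
Proof.
rewrite /linext /unifE exchange_big mulr_suml; apply: eq_bigr => g _ /=.
by rewrite -[LHS]/(_ * _) mulrA mulr_sumr.
Qed.

Definition moment (y : CG) (N j : nat) : R :=
  complex.Re (unifE (homs G N) (fun phi => ntrace (pi_alg phi (y ^+ j)))).

(** For [h] without constant term the statistic is the average of
    [\sum_i h (d i)] over the eigenvalues of the random matrix. *)
Lemma pairing_moment (x : CG) (y := grpalg_star x * x) N (h : {poly R}) :
  finite_set (homs G N) -> (0 < N)%N -> h`_0 = 0 ->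
  exists d : (G -> 'S_N) -> 'I_N -> R,
    [/\ forall phi, homs G N phi -> forall i, 0 <= d phi i <= l1 y,
        forall phi, homs G N phi -> forall r, 0 <= r ->
          (forall i, d phi i <= r ^+ 2) ->
          (std_norm (pi_alg phi x) <= r%:E)%E &
        N%:R * pairing (moment y N) h =
        (\sum_(phi <- fset_set (homs G N)) \sum_i h.[d phi i]) /
        (#|` fset_set (homs G N)|)%:R].
Proof.
move=> finH N0 h0.
have ex phi : exists d : 'I_N -> R, homs G N phi ->
  [/\ forall i, 0 <= d i <= l1 y,
      forall j, (0 < j)%N ->
        ntrace (pi_alg phi (y ^+ j)) = ((\sum_i d i ^+ j) / N%:R)%:C &
      forall r, 0 <= r -> (forall i, d i <= r ^+ 2) ->
        (std_norm (pi_alg phi x) <= r%:E)%E].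
  have [H|nH] := pselect (homs G N phi); last by exists (fun=> 0).
  by have [d dP] := spectral_moments N0 H x; exists d.
have [d dP] := choice ex.
exists d; split=> [phi /dP[]//|phi /dP[]//|].
have NR : N%:R != 0 :> R by rewrite pnatr_eq0 -lt0n.
have mE j : (0 < j)%N -> N%:R * moment y N j =
    (\sum_(phi <- fset_set (homs G N)) \sum_i d phi i ^+ j) /
    (#|` fset_set (homs G N)|)%:R.
  move=> j0; rewrite /moment (@unifE_real _ _ _ finH
    (fun phi => (\sum_i d phi i ^+ j) / N%:R)); last first.
    by move=> phi /dP[_ -> //].
  by rewrite -[complex.Re _]/(_ / _) -mulr_suml; field; rewrite NR gt_eqF ?card_fset_set_gt0 //;
    exact: homs_nonempty.
rewrite /pairing mulr_sumr.
under [X in _ = X / _]eq_bigr => phi _.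
  under eq_bigr => i _ do rewrite horner_coef.
  rewrite exchange_big /=.
  over.
rewrite exchange_big mulr_suml; apply: eq_bigr => j _ /=.
under [X in _ = X / _]eq_bigr => phi _ do rewrite -mulr_sumr.
rewrite -mulr_sumr; have [->|j0] := posnP j; first by rewrite h0 !mul0r mulr0.
by rewrite mulrCA mE // mulrA.
Qed.

End RandomModel.

(** * Hypotheses of the theorem in terms of moments *)

Section MomentHypotheses.
Variables (R : realType) (G : groupType).
Local Notation CG := (grpalg R[i] G).

(** The real constant of the hypothesis is replaced by an integer, and [K] is
    the maximal word length in the support of [y], so that [y ^+ j] is
    supported on words of length at most [j * K]. *)
Lemma expansion_moment (S : {fset G}) (genS : generates S) (mu : nat)
    (C : R) (u : nat -> G -> R) (y : CG) :
  (0 < mu)%N -> 1 <= C ->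
  (forall (g : G) (s N : nat),
       (0 < s)%N -> (word_length genS g <= s)%N ->
       C * s%:R `^ C <= N%:R ->
       normc (unifE (homs G N) (fun phi => ntrace (pi_rep R phi g))
              - (\sum_(0 <= k < s) u k g / N%:R `^ (k%:R / mu%:R))%:C)
       <= (C * s%:R) `^ (C * s%:R) / N%:R `^ (s%:R / mu%:R)) ->
  exists K c : nat, (0 < c)%N /\ forall j s N, (0 < s)%N -> (j * K <= s)%N ->
    (c * s ^ c <= N)%N ->
    `|moment y N j - \sum_(k < s)
        complex.Re (linext (V := R[i]) (fun g => (u k g)%:C) (y ^+ j)) *
        invroot R mu N ^+ k| <=
    l1 y ^+ j * ((c * s)%:R ^+ (c * s) * invroot R mu N ^+ s).
Proof.
move=> mu0 C1 expansion.
pose K := (\max_(g <- msupp y) word_length genS g)%N.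
pose c := (Num.trunc C).+1.
have Cc : C <= c%:R.
  by have /andP[_ /ltW] := truncn_itv (le_trans ler01 C1).
exists K, c; split=> // j s N s0 jK cN.
have sR : 1 <= s%:R :> R by rewrite ler1n.
have yK g : g \in msupp y -> (word_length genS g <= K)%N.
  by move=> gy; apply: leq_bigmax_seq.
have CN : C * s%:R `^ C <= N%:R.
  apply: (@le_trans _ _ (c * s ^ c)%:R); last by rewrite ler_nat.
  rewrite natrM natrX -powR_mulrn ?ler0n //.
  by apply: ler_pM; rewrite ?powR_ge0 ?ler_powR //; lra.
have bound : (C * s%:R) `^ (C * s%:R) / N%:R `^ (s%:R / mu%:R) <=
    (c * s)%:R ^+ (c * s) * invroot R mu N ^+ s.
  rewrite invrootX invrK ler_wpM2r ?exprn_ge0 ?invr_ge0 ?powR_ge0 //.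
  have Cs1 : 1 <= C * s%:R by rewrite mulr_ege1.
  have Cs : C * s%:R <= (c * s)%:R by rewrite natrM ler_wpM2r.
  rewrite -[leRHS]powR_mulrn ?ler0n //.
  apply: (@le_trans _ _ ((C * s%:R) `^ (c * s)%:R)); first by rewrite ler_powR.
  by rewrite ge0_ler_powR ?nnegrE ?ler0n //; lra.
have := @Re_expansion R G
  (fun g => unifE (homs G N) (fun phi => ntrace (pi_rep R phi g))) u (y ^+ j) s
  (invroot R mu N) ((c * s)%:R ^+ (c * s) * invroot R mu N ^+ s).
move=> h; apply: le_trans (le_trans (h _) _).
- rewrite /moment (linext_unifE _ (fun phi g => ntrace (pi_rep R phi g))).
  suff -> : (fun phi : G -> 'S_N => ntrace (pi_alg phi (y ^+ j))) =
    (fun phi => linext (V := R[i]) (fun g => ntrace (pi_rep R phi g)) (y ^+ j)).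
    by [].
  by apply/funext => phi; rewrite ntrace_linext.
- move=> g gy; apply: le_trans bound.
  have gs : (word_length genS g <= s)%N.
    exact: leq_trans (word_length_msuppX yK gy) jK.
  have := expansion g s N s0 gs CN; rewrite big_mkord.
  by under eq_bigr => k _ do rewrite invrootX invrK.
- rewrite ler_wpM2r ?l1X // mulr_ge0 ?exprn_ge0 // invr_ge0 powR_ge0 //.
Qed.

(** The coefficient of order [0] is the canonical trace and is bounded directly;
    the others are bounded by temperedness. *)
Lemma low_order_bound (mu : nat) (u : nat -> G -> R) (y : CG) (r0 r1 : R) :
  0 <= r0 -> r0 < r1 -> (lambda_norm y <= r0%:E)%E ->
  (forall g : G, (u 0%N g)%:C = tau (@lreg R G g)) ->
  (forall k : nat, (1 <= k <= mu)%N ->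
     tempered (linext (V := R[i]) (fun g => (u k g)%:C)) y) ->
  exists2 B : R, 0 <= B & forall k j, (k <= mu)%N ->
    `|complex.Re (linext (V := R[i]) (fun g => (u k g)%:C) (y ^+ j))| <=
    B * r1 ^+ j.
Proof.
move=> r00 r01 yr u0E temp; have r10 : 0 < r1 by apply: le_lt_trans r01.
have ex k : exists B : R, 0 <= B /\ ((k <= mu)%N -> forall j,
    normc (linext (V := R[i]) (fun g => (u k g)%:C) (y ^+ j)) <= B * r1 ^+ j).
  case: k => [|k].
    exists 1; split=> // _ j; rewrite mul1r.
    suff -> : linext (V := R[i]) (fun g => (u 0%N g)%:C) (y ^+ j) =
        mcoeff 1%g (y ^+ j).
      apply: le_trans (normc_mcoeff1_exp j r00 yr) _.
      by rewrite lerXn2r ?nnegrE ?(ltW r01) ?(ltW r10).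
    rewrite /linext [in RHS](grpalgE (y ^+ j)) mcoeff_sum; apply: eq_bigr => g _.
    rewrite u0E tau_lreg mcoeff_gterm -[LHS]/(_ * _).
    by case: (g == _); rewrite ?mulr1 ?mulr0.
  case: (leqP k.+1 mu) => kmu; last by exists 0.
  have [B B0 BP] := tempered_bound r10 r01 (temp k.+1 kmu) yr.
  by exists B.
have [B BP] := choice ex.
exists (\sum_(k < mu.+1) B k) => [|k j kmu].
  by apply: sumr_ge0 => k _; case: (BP k).
apply: le_trans (Re_le_normc _) _; have [Bk h] := BP k.
apply: le_trans (h kmu j) _; rewrite ler_wpM2r ?exprn_ge0 ?(ltW r10) //.
have kmu' : (k < mu.+1)%N by [].
rewrite (bigD1 (Ordinal kmu')) //= lerDl; apply: sumr_ge0 => i _.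
by case: (BP i).
Qed.

End MomentHypotheses.

(** * The strong convergence theorem *)

Lemma homs_good_cvg1 (R : realType) (G : groupType)
    (finH : forall N, finite_set (homs G N)) (Good : forall N, set (G -> 'S_N)) :
  (fun N => unifP R (homs G N) (~` Good N)) @ \oo --> (0 : R) ->
  (fun N => unifP R (homs G N) (Good N)) @ \oo --> (1 : R).
Proof.
move=> bad0.
have -> : (fun N => unifP R (homs G N) (Good N)) =
    (fun N => 1 - unifP R (homs G N) (~` Good N)).
  by apply/funext => N; exact: (unifPC _ (finH N) (@homs_nonempty G N)).
by rewrite -[X in _ --> X]subr0; apply: cvgB => //; exact: cvg_cst.
Qed.

Lemma lambda_norm_ge0 (R : realType) (G : groupType) (x : grpalg R[i] G) :
  (0 <= lambda_norm x)%E.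
Proof.
have z : lambda x (fun=> 0) = (fun=> 0).
  by apply/funext => h; rewrite /lambda /linext fct_sumE big1 // => g _;
    exact: mulr0.
have n0 : ell2norm ((fun=> 0) : G -> R[i]) = 0%E :> \bar R.
  rewrite /ell2norm esum1 ?sqrte0 // => g _.
  by rewrite normc0 expr0n.
apply: ereal_sup_ubound; exists (fun=> 0) => /=; first by rewrite n0 lee_fin.
by rewrite z n0.
Qed.

Theorem theorem1p2 (R : realType) (G : groupType) (S : {fset G})
    (symS : symmetric_fset S) (genS : generates S)
    (mu : nat) (mu_gt0 : (0 < mu)%N)
    (C : R) (C_ge1 : 1 <= C) (u : nat -> G -> R)
    (u0E : forall g : G, (u 0%N g)%:C = tau (@lreg R G g))
    (expansion : forall (g : G) (s N : nat),
       (0 < s)%N -> (word_length genS g <= s)%N ->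
       C * s%:R `^ C <= N%:R ->
       normc (unifE (homs G N) (fun phi => ntrace (pi_rep R phi g))
              - (\sum_(0 <= k < s) u k g / N%:R `^ (k%:R / mu%:R))%:C)
       <= (C * s%:R) `^ (C * s%:R) / N%:R `^ (s%:R / mu%:R))
    (u_tempered : forall k : nat, (1 <= k <= mu)%N ->
       forall x : grpalg R[i] G, self_adjoint x ->
       tempered (linext (fun g => (u k g)%:C)) x) :
  forall (x : grpalg R[i] G) (eps : R), 0 < eps ->
    (fun N : nat => unifP R (homs G N)
       [set phi | (std_norm (pi_alg phi x) <= lambda_norm x + eps%:E)%E])
    @ \oo --> (1 : R).
Proof.
move=> x eps eps0.
have finH N : finite_set (homs G N) := finite_homs N genS.
apply: homs_good_cvg1 => //.
have lx0 := lambda_norm_ge0 x.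
have [lxfin|lxinf] := boolP (lambda_norm x \is a fin_num); last first.
  (* With an infinite right-hand side the bad event is empty. *)
  have lxE : lambda_norm x = +oo%E.
    by move: lx0 lxinf; case: (lambda_norm x).
  have -> : (fun N => unifP R (homs G N) (~` [set phi |
      (std_norm (pi_alg phi x) <= lambda_norm x + eps%:E)%E])) = fun=> 0.
    apply/funext => N; rewrite /unifP (_ : _ `&` _ = set0).
      by rewrite fset_set0 cardfs0 mul0r.
    by apply/seteqP; split=> // phi [_]; rewrite /= lxE addye // leey.
  exact: cvg_cst.
pose rho := fine (lambda_norm x).
have lxE : lambda_norm x = rho%:E by rewrite fineK.
have rho0 : 0 <= rho by rewrite -lee_fin -lxE.
pose y := grpalg_star x * x.
have yr : (lambda_norm y <= ((rho + eps / 4) ^+ 2)%:E)%E.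
  by apply: lambda_norm_starM; [lra | rewrite lxE lee_fin; lra].
have r01 : (rho + eps / 4) ^+ 2 < (rho + eps / 2) ^+ 2.
  by rewrite ltr_pXn2r // ?nnegrE; lra.
have r12 : (rho + eps / 2) ^+ 2 < (rho + eps) ^+ 2.
  by rewrite ltr_pXn2r // ?nnegrE; lra.
have r1_gt0 : 0 < (rho + eps / 2) ^+ 2 by rewrite exprn_gt0 //; lra.
(* All eigenvalues lie in [[0, l1 y]]; the summand makes [A] exceed the
   threshold [(rho + eps) ^+ 2] too. *)
pose A := l1 y + (rho + eps) ^+ 2.
have r2A : (rho + eps) ^+ 2 <= A by rewrite lerDr l1_ge0.
have [B B0 lowB] := low_order_bound (sqr_ge0 _) r01 yr u0E
  (fun k kmu => u_tempered k kmu y (self_adjoint_starM x)).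
have [K [c [c0 expand]]] := expansion_moment y mu_gt0 C_ge1 expansion.
apply: (bad_cvg0 mu_gt0 c0 (l1_ge0 y) B0 r1_gt0 r12 r2A expand lowB).
- move=> N h N0 h0 h01.
  have [d [d01 _ avg]] := pairing_moment x (finH N) N0 h0.
  have NR : 0 < N%:R :> R by rewrite ltr0n.
  have hd phi : homs G N phi -> forall i, 0 <= h.[d phi i] <= 1.
    move=> H i; apply: h01; have /andP[-> di] := d01 phi H i.
    by apply: le_trans di _; rewrite lerDl sqr_ge0.
  have c0' := card_fset_set_gt0 R (finH N) (@homs_nonempty G N).
  set X := pairing _ _ in avg *.
  have -> : X = (\sum_(phi <- fset_set (homs G N)) \sum_i h.[d phi i]) /
      (#|` fset_set (homs G N)|)%:R / N%:R.
    by rewrite -avg mulrAC mulfV ?mul1r // gt_eqF.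
  rewrite ger0_norm; last first.
    rewrite !divr_ge0 // big_seq sumr_ge0 // => phi.
    rewrite (in_fset_set (finH N)) => /set_mem H; apply: sumr_ge0 => i _.
    by have /andP[] := hd phi H i.
  rewrite !ler_pdivrMr // mul1r mulrC.
  have -> : (#|` fset_set (homs G N)|)%:R * N%:R =
      \sum_(phi <- fset_set (homs G N)) (N%:R : R).
    by rewrite big_const_seq count_predT iter_addr_0 mulr_natl.
  rewrite big_seq [leRHS]big_seq; apply: ler_sum => phi.
  rewrite (in_fset_set (finH N)) => /set_mem H.
  have -> : N%:R = \sum_(i < N) (1 : R) by rewrite sumr_const card_ord.
  by apply: ler_sum => i _; have /andP[] := hd phi H i.
- by move=> N; exact: unifP_ge0.
- move=> N h k N0 h0 h01 hk.
  have [d [d01 dnorm ->]] := pairing_moment x (finH N) N0 h0.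
  have hd phi : homs G N phi -> forall i, 0 <= h.[d phi i] <= 1.
    move=> H i; apply: h01; have /andP[-> di] := d01 phi H i.
    by apply: le_trans di _; rewrite lerDl sqr_ge0.
  apply: (unifP_markov (finH N)) => phi H.
    by apply: sumr_ge0 => i _; have /andP[] := hd phi H i.
  move=> /= bad.
  have [i di] : exists i, (rho + eps) ^+ 2 < d phi i.
    apply: contrapT => none; apply: bad; rewrite lxE; apply: dnorm => //; first lra.
    by move=> i; rewrite leNgt; apply/negP => h'; apply: none; exists i.
  have hki : k <= h.[d phi i].
    apply: hk; rewrite (ltW di) /=; have /andP[_ h'] := d01 phi H i.
    by apply: le_trans h' _; rewrite lerDl sqr_ge0.
  apply: le_trans hki _; rewrite (bigD1 i) //= lerDl sumr_ge0 // => j _.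
  by have /andP[] := hd phi H j.
Qed.
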